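(* Let $\mathcal{C}$ be a class of graphs such that there exists an integer $t\geq 1$ such that no $G\in\mathcal{C}$ contains $K_{t,t}$ as a subgraph. Then there exist a constant $c$ depending on $\mathcal{C}$ and a polynomial-time algorithm which, for every input graph $G\in\mathcal{C}$, either outputs a contraction sequence of $G$ of width at most $c$, or correctly outputs that $G$ has twin-width more than $2$.
   Context: All graphs are finite and simple (no loops, no multiple edges). ''Subgraph'' means not necessarily induced subgraph. $K_{t,t}$ is the complete bipartite graph with both sides of size $t$. Trigraph: a simple graph $G$ in which some edges are marked red (the other edges are black). ''Neighbour'' and $N_G(x)$ refer to all edges (red and black); $N^r_G(x)$ denotes the set of red neighbours of $x$, and the red degree of $x$ is $|N_G^r(x)|$. A contraction of a pair of distinct (not necessarily adjacent) vertices $x_1,x_2$ of a trigraph $G$ produces the trigraph $G'$ that is the same as $G$ except that $x_1,x_2$ are replaced by one new vertex $x_0$ with $N_{G'}(x_0)=(N_G(x_1)\cup N_G(x_2))\setminus\{x_1,x_2\}$ and $N^r_{G'}(x_0)=\big(N^r_G(x_1)\cup N^r_G(x_2)\cup (N_G(x_1)\,\Delta\, N_G(x_2))\big)\setminus\{x_1,x_2\}$, where $\Delta$ is symmetric difference. A contraction sequence of a trigraph $G$ is a sequence of successive contractions turning $G$ into a single vertex; its width is the maximum red degree of any vertex in any trigraph of the sequence. The twin-width of $G$ is the minimum width over all contraction sequences of $G$. For an ordinary graph $G$, these notions are applied to $G$ viewed as a trigraph with no red edges. Polynomial time is with respect to the size of the input graph $G$, with $\mathcal{C}$ (and hence $t$)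 fixed. *)

(* Defs.v *)
From mathcomp Require Import all_boot ssralg poly.

Set Implicit Arguments.
Unset Strict Implicit.
Unset Printing Implicit Defensive.

(* Graphs are non-empty, since only these can be contracted to one vertex. The
   vertices are numbered, so that a graph can be given as input to a program. *)
Record sgraph := SGraph {
  nvert : nat;
  adj : rel 'I_nvert;
  nvert_gt0 : 0 < nvert;
  adj_sym : symmetric adj;
  adj_irr : irreflexive adj
}.

Definition contains_subgraph (T U : finType) (e : rel T) (f : rel U) : Prop :=
  exists2 h : T -> U, injective h & forall x y, e x y -> f (h x) (h y).

Definition Kbip (t : nat) : rel ('I_t + 'I_t) := fun x y =>
  match x, y with
  | inl _, inr _ | inr _, inl _ => true
  | _, _ => false
  end.
Arguments Kbip : clear implicits.

(* The vertex set is a subset of the fixed type T: contractions shrink it. *)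
Record trigraph (T : finType) := Trigraph {
  tvert : {set T};
  tadj : rel T;
  tred : rel T;
  tvert_neq0 : tvert != set0;
  tadj_sym : symmetric tadj;
  tadj_irr : irreflexive tadj;
  tadj_vert : forall x y, tadj x y -> x \in tvert;
  tred_sym : symmetric tred;
  tred_adj : subrel tred tadj
}.

Section Trigraph.
Variable T : finType.
Implicit Types (H : trigraph T) (s : seq (T * T)).

Definition nbr H x : {set T} := [set y | tadj H x y].
Definition rnbr H x : {set T} := [set y | tred H x y].

Definition max_red_deg H : nat := \max_(x in tvert H) #|rnbr H x|.

Section Contract.
Variables (H : trigraph T) (x1 x2 : T).

Definition new_nbr : {set T} :=
  (nbr H x1 :|: nbr H x2) :\: [set x1; x2].

Definition new_rnbr : {set T} :=
  (rnbr H x1 :|: rnbr H x2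
     :|: ((nbr H x1 :\: nbr H x2) :|: (nbr H x2 :\: nbr H x1)))
  :\: [set x1; x2].

(* The relation obtained from e by replacing x1 and x2 with a new vertex having
   neighbourhood N; the new vertex takes over the name x1. *)
Definition replace_rel (e : rel T) (N : {set T}) : rel T := fun u v =>
  if u == x1 then v \in N
  else if v == x1 then u \in N
  else [&& u != x2, v != x2 & e u v].

Definition contract_vert : {set T} := x1 |: (tvert H :\ x2).
Definition contract_adj : rel T := replace_rel (tadj H) new_nbr.
Definition contract_red : rel T := replace_rel (tred H) new_rnbr.

Lemma replace_rel_sym e (N : {set T}) :
  symmetric e -> symmetric (replace_rel e N).
Proof.
move=> es u v; rewrite /replace_rel es [in RHS]andbCA.
by case: (eqVneq u x1) => [->|_]; case: (eqVneq v x1) => [E|_];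
  rewrite ?E ?eqxx.
Qed.

Lemma contract_vert_neq0 : contract_vert != set0.
Proof. by apply/set0Pn; exists x1; rewrite setU11. Qed.

Lemma contract_adj_sym : symmetric contract_adj.
Proof. exact: replace_rel_sym (@tadj_sym _ H). Qed.

Lemma contract_adj_irr : irreflexive contract_adj.
Proof.
move=> u; rewrite /contract_adj /replace_rel.
by case: eqP => [->|_]; rewrite ?inE ?eqxx // tadj_irr !andbF.
Qed.

Lemma contract_adj_vert u v : contract_adj u v -> u \in contract_vert.
Proof.
rewrite /contract_adj /replace_rel /contract_vert in_setU1 in_setD1.
have [//|_] := eqVneq u x1; have [_|_] := eqVneq v x1.
  rewrite !inE negb_or => /andP[/andP[_ ->]].
  by case/orP; rewrite tadj_sym => /tadj_vert.
by case/and3P=> -> _ /tadj_vert.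
Qed.

Lemma contract_red_sym : symmetric contract_red.
Proof. exact: replace_rel_sym (@tred_sym _ H). Qed.

Lemma new_rnbr_sub : new_rnbr \subset new_nbr.
Proof.
apply/subsetP => u; rewrite !inE => /andP[->] /=.
have R x : tred H x u -> tadj H x u by apply: tred_adj.
by case/orP => [/orP[/R->|/R->]|/orP[/andP[_ ->]|/andP[_ ->]]]; rewrite ?orbT.
Qed.

Lemma contract_red_adj : subrel contract_red contract_adj.
Proof.
move=> u v; rewrite /contract_red /contract_adj /replace_rel.
case: eqP => _; first exact: (subsetP new_rnbr_sub).
case: eqP => _; first exact: (subsetP new_rnbr_sub).
by move=> /and3P[-> -> /tred_adj].
Qed.

Definition contract : trigraph T :=
  Trigraph contract_vert_neq0 contract_adj_sym contract_adj_irr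
    contract_adj_vert contract_red_sym contract_red_adj.

End Contract.

(* A contraction sequence is given by the successive contracted pairs; the
   vertex made from (x, y) is called x in the later pairs. *)
Fixpoint contraction_seq H s : bool :=
  if s is (x, y) :: s' then
    [&& x != y, x \in tvert H, y \in tvert H
      & contraction_seq (contract H x y) s']
  else #|tvert H| == 1.

Fixpoint width H s : nat :=
  maxn (max_red_deg H)
    (if s is (x, y) :: s' then width (contract H x y) s' else 0).

Definition has_width H k : bool :=
  [exists s : (#|tvert H|.-1).-tuple (T * T),
     contraction_seq H s && (width H s == k)].

Lemma card_contract H x y : x != y -> x \in tvert H -> y \in tvert H ->
  #|tvert H| = #|tvert (contract H x y)|.+1.
Proof.
move=> nxy xH yH; rewrite (cardsD1 y) yH /=; congr _.+1.
by apply: eq_card => z; rewrite !inE; have [->|//] := eqVneq z x;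
  rewrite nxy xH.
Qed.

Lemma size_contraction_seq H s : contraction_seq H s -> size s = #|tvert H|.-1.
Proof.
elim: s H => [|[x y] s IHs] H /=; first by move/eqP->.
case/and4P=> nxy xH yH /IHs->; rewrite (card_contract nxy xH yH) /=.
by rewrite prednK // card_gt0 (tvert_neq0 (contract H x y)).
Qed.

Lemma has_widthP H k :
  reflect (exists2 s, contraction_seq H s & width H s = k) (has_width H k).
Proof.
apply: (iffP existsP) => [[s /andP[sH /eqP wH]]|[s sH wH]]; first by exists s.
have sz : size s == #|tvert H|.-1 by apply/eqP/size_contraction_seq.
by exists (Tuple sz); rewrite /= sH wH eqxx.
Qed.

Lemma exists_width H : exists k, has_width H k.
Proof.
suff [s sH] : exists s, contraction_seq H s.
  by exists (width H s); apply/has_widthP; exists s.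
have [n] := ubnP #|tvert H|; elim: n H => // n IHn H ltHn.
have [H1|H1] := eqVneq #|tvert H| 1; first by exists [::]; apply/eqP.
have /card_gt1P[x [y [xH yH nxy]]] : 1 < #|tvert H|.
  by rewrite ltn_neqAle eq_sym H1 card_gt0 tvert_neq0.
have [|s sH] := IHn (contract H x y).
  by rewrite -ltnS -(card_contract nxy xH yH).
by exists ((x, y) :: s); rewrite /= nxy xH yH.
Qed.

Definition twin_width H : nat := ex_minn (exists_width H).

End Trigraph.

Section TrigraphOfGraph.
Variable G : sgraph.

Lemma graph_vert_neq0 : [set: 'I_(nvert G)] != set0.
Proof. by apply/set0Pn; exists (Ordinal (nvert_gt0 G)); rewrite inE. Qed.

Lemma graph_adj_vert (x y : 'I_(nvert G)) :
  adj x y -> x \in [set: 'I_(nvert G)].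
Proof. by rewrite inE. Qed.

Definition no_red : rel 'I_(nvert G) := fun _ _ => false.

Lemma no_red_sym : symmetric no_red. Proof. by []. Qed.

Lemma no_red_adj : subrel no_red (@adj G). Proof. by []. Qed.

Definition tri : trigraph 'I_(nvert G) :=
  Trigraph graph_vert_neq0 (@adj_sym G) (@adj_irr G) graph_adj_vert
    no_red_sym no_red_adj.

End TrigraphOfGraph.

(* Algorithms are random access programs over finitely many unbounded arrays of
   natural numbers. The arithmetic is addition and truncated subtraction only:
   with a unit-cost multiplication, repeated squaring would make this model
   stronger than Turing machines, whereas as it stands a run of T steps only
   handles numbers of O(T + input size) bits, so that the model is polynomially
   equivalent to Turing machines. *)
Inductive expr :=
  | Cst (n : nat)
  | Get (a : nat) (i : expr)  (* the cell of index i in array a *)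
  | Add (e1 e2 : expr)
  | Sub (e1 e2 : expr).

Inductive prog :=
  | Skip
  | Put (a : nat) (i e : expr)  (* store e in the cell of index i in array a *)
  | Seq (p q : prog)
  | If (e : expr) (p q : prog)
  | While (e : expr) (p : prog).

(* [st a i] is the content of the cell of index i in array a. *)
Definition store := nat -> nat -> nat.

Definition update (st : store) (a i v : nat) : store := fun b j =>
  if (b == a) && (j == i) then v else st b j.

Fixpoint eval (st : store) (e : expr) : nat :=
  match e with
  | Cst n => n
  | Get a i => st a (eval st i)
  | Add e1 e2 => eval st e1 + eval st e2
  | Sub e1 e2 => eval st e1 - eval st e2
  end.

(* [exec p st k st'] : started in st, the program p halts in st' after k steps.
   Each assignment and each test of a condition (true when nonzero) counts as
   one step; the expressions involved have a size fixed by the program. *)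
Inductive exec : prog -> store -> nat -> store -> Prop :=
  | ExecSkip st : exec Skip st 0 st
  | ExecPut a i e st :
      exec (Put a i e) st 1 (update st a (eval st i) (eval st e))
  | ExecSeq p q st st' st'' k l :
      exec p st k st' -> exec q st' l st'' -> exec (Seq p q) st (k + l) st''
  | ExecIfTrue e p q st st' k :
      eval st e != 0 -> exec p st k st' -> exec (If e p q) st k.+1 st'
  | ExecIfFalse e p q st st' k :
      eval st e = 0 -> exec q st k st' -> exec (If e p q) st k.+1 st'
  | ExecWhileFalse e p st :
      eval st e = 0 -> exec (While e p) st 1 st
  | ExecWhileTrue e p st st' st'' k l :
      eval st e != 0 -> exec p st k st' -> exec (While e p) st' l st'' ->
      exec (While e p) st (k + l).+1 st''.

(* The input: array 0 holds the number n of vertices in its first cell, and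
   array 1 the adjacency matrix, with entry (i, j) in cell i * n + j. All the
   other cells are 0. *)
Definition input (G : sgraph) : store := fun a k =>
  match a with
  | 0 => if k == 0 then nvert G else 0
  | 1 => [exists i : 'I_(nvert G), exists j : 'I_(nvert G),
            (k == i * nvert G + j) && adj i j]
  | _ => 0
  end.

(* The output: cell 0 of array 2 holds the verdict, which is 0 for the answer
   "twin-width more than 2", and 1 for a sequence of pairs; in the latter case
   cell 1 of array 2 holds the length of the sequence, and arrays 3 and 4 hold
   the first and the second components of the pairs. *)
Definition outputs_large (st : store) : Prop := st 2 0 = 0.

Definition outputs_seq (n : nat) (st : store) (s : seq ('I_n * 'I_n)) : Prop :=
  st 2 0 = 1 /\
  [seq (val p.1, val p.2) | p <- s]
    = mkseq (fun k => (st 3 k, st 4 k)) (st 2 1).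

(* Main.v *)
(* Let K(A) be the set of common neighbours of a set A. Without K_{t,t}, it has at
   most t elements as soon as A is big, i.e. has at least t elements. Consider a
   contraction sequence of width at most 2, and at some stage a red path
   a0 a1 a2 a3 such that the parts of a1 and a2 are big. As the black edges at
   these parts are covered by K(a1) and K(a2), and as there is no room for another
   red edge at a1 or a2, an induction on the sequence shows that O(t) vertices
   separate a0 from a3 within the path. Hence a big part has a small separator
   from everything at red distance at least 3, and the first part to contain a
   given fraction of a set W yields a balanced separator of W with O(t) vertices.

   The algorithm grows a set Q such that every component outside Q has a bounded
   number of neighbours in Q, by trying all the ways of adding at most 7t
   vertices. By the balanced separators this only gets stuck when the twin-width
   is more than 2. The vertices are then removed from Q in the reverse order, so
   that the components outside Q get merged one by one; in the meantime, the
   vertices of a component that have the same neighbours outside are contracted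
   together. All the red edges lie within the components, each of which has been
   contracted to a bounded number of vertices. *)
Require Import Defs.
From mathcomp Require Import all_boot ssralg poly.
From mathcomp Require Import zify.

Set Implicit Arguments.
Unset Strict Implicit.
Unset Printing Implicit Defensive.

(** * Separators from contraction sequences *)

(** Width 2 enters only through [deg2_uniq]: a third red neighbour is impossible. The obstacle in
    the induction is that a red path of the new trigraph need not have been red before, since a
    contraction creates red edges. The red edges missing earlier were black or absent, and black
    edges at a big part are charged to its at most [t] common neighbours; the red edges that were
    there form an earlier path, whose separator is reused.

    Edges between the parts of [a0] and [a3] cannot be charged in this way, as both parts may be
    small, so [separated] has to exempt them. This does no harm in the end: one starts from a big
    part [a0], which contributes its own common neighbours, and each of its red edges is followed
    separately.

    On the algorithmic side, no trigraph is ever stored. Between different pieces it agrees with the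
    input graph, so that the labels of the pieces and the list of vanished vertices determine every
    decision. *)

Section Contraction.
Variables (T : finType) (H : trigraph T) (x y : T).

Lemma contract_adj_new v : tadj (contract H x y) x v =
  [&& v != x, v != y & tadj H x v || tadj H y v].
Proof.
by rewrite /= /contract_adj /replace_rel eqxx !inE negb_or andbA.
Qed.

Lemma contract_adj_old u v : u != x -> v != x ->
  tadj (contract H x y) u v = [&& u != y, v != y & tadj H u v].
Proof.
by move=> /negPf ux /negPf vx; rewrite /= /contract_adj /replace_rel ux vx.
Qed.

Lemma contract_red_new v : tred (contract H x y) x v =
  [&& v != x, v != y & [|| tred H x v, tred H y v | tadj H x v != tadj H y v]].
Proof.
rewrite /= /contract_red /replace_rel eqxx !inE negb_or -!andbA.
by case: (tadj H x v); case: (tadj H y v); case: (tred H x v);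
  case: (tred H y v); rewrite ?orbT ?orbF.
Qed.

Lemma contract_red_old u v : u != x -> v != x ->
  tred (contract H x y) u v = [&& u != y, v != y & tred H u v].
Proof.
by move=> /negPf ux /negPf vx; rewrite /= /contract_red /replace_rel ux vx.
Qed.

Lemma in_contract_vert u : x != y -> x \in tvert H ->
  (u \in tvert (contract H x y)) = (u != y) && (u \in tvert H).
Proof.
move=> nxy xH; rewrite /= /contract_vert !inE.
by have [->|//] := eqVneq u x; rewrite nxy xH.
Qed.

End Contraction.

Lemma tred_irr (T : finType) (H : trigraph T) : irreflexive (tred H).
Proof. by move=> u; apply/negP => /tred_adj; rewrite tadj_irr. Qed.

Lemma tred_vert (T : finType) (H : trigraph T) u v :
  tred H u v -> u \in tvert H.
Proof. by move/tred_adj/tadj_vert. Qed.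

Section Separation.
Variables (T : finType) (e : rel T) (t : nat).
Hypothesis e_sym : symmetric e.

Definition common_nbr (A : {set T}) : {set T} :=
  [set v | [forall a in A, e v a]].

Hypothesis common_nbr_card :
  forall A : {set T}, t <= #|A| -> #|common_nbr A| <= t.

Implicit Types (f : T -> T) (H : trigraph T) (A B X Z : {set T}).

Lemma common_nbrS A B : A \subset B -> common_nbr B \subset common_nbr A.
Proof.
move=> /subsetP sAB; apply/subsetP => v; rewrite !inE => /forall_inP vB.
by apply/forall_inP => a /sAB/vB.
Qed.

Definition part f a : {set T} := [set u | f u == a].

Lemma in_part f a u : (u \in part f a) = (f u == a).
Proof. by rewrite inE. Qed.

(* [f] maps each vertex of the graph to the vertex of the trigraph [H] that it
   has been contracted into. *)
Record quotient f H : Prop := Quotient {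
  quotient_vert : forall u, f u \in tvert H;
  quotient_adj : forall u v, f u != f v -> e u v -> tadj H (f u) (f v);
  quotient_black : forall u v,
    tadj H (f u) (f v) -> ~~ tred H (f u) (f v) -> e u v
}.

(** The edge from [u] to [v] forces an edge of [H], which is black here, and a black edge stands for
    all the pairs across the two parts. *)
Lemma quotient_common f H u v : quotient f H -> f u != f v ->
  ~~ tred H (f u) (f v) -> e u v -> u \in common_nbr (part f (f v)).
Proof.
move=> qf nuv ruv euv; rewrite inE; apply/forall_inP => w.
rewrite inE => /eqP wv.
apply: (quotient_black qf); rewrite ?wv //.
exact: quotient_adj qf _ _ nuv euv.
Qed.

Definition merge f x y u := if f u == y then x else f u.

Variant merge_spec f x y u : T -> Prop :=
  | MergeNew of f u = x \/ f u = y : merge_spec f x y u x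
  | MergeOld of f u != x & f u != y : merge_spec f x y u (f u).

Lemma mergeP f x y u : merge_spec f x y u (merge f x y u).
Proof.
rewrite /merge; have [uy|uy] := eqVneq (f u) y.
  by constructor; right.
by have [ux|ux] := eqVneq (f u) x; [rewrite ux|]; constructor => //; left.
Qed.

Lemma quotient_contract f H x y : x != y -> x \in tvert H -> y \in tvert H ->
  quotient f H -> quotient (merge f x y) (contract H x y).
Proof.
move=> nxy xH yH qf; split.
- move=> u; rewrite in_contract_vert //.
  by case: (mergeP f x y u) => [_|_ ->]; rewrite ?nxy ?xH ?quotient_vert.
- have main u v : f u = x \/ f u = y -> f v != x -> f v != y -> e u v ->
      tadj (contract H x y) x (f v).
    rewrite contract_adj_new => ux vx vy euv; rewrite vx vy /=.
    have adjH nuv := quotient_adj qf nuv euv.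
    by case: ux adjH => -> adjH; rewrite adjH ?orbT // eq_sym.
  move=> u v.
  case: (mergeP f x y u) => [ux|ux uy]; case: (mergeP f x y v) => [vx|vx vy].
  + by rewrite eqxx.
  + by move=> _; apply: main.
  + by move=> _; rewrite e_sym tadj_sym; apply: main.
  by rewrite contract_adj_old // uy vy; apply: quotient_adj.
have main u v : f u = x \/ f u = y -> f v != x -> f v != y -> 
    tadj (contract H x y) x (f v) -> ~~ tred (contract H x y) x (f v) -> e u v.
  rewrite contract_adj_new contract_red_new => ux vx vy.
  rewrite vx vy /= !negb_or negbK => adjv /and3P[rx ry /eqP xy].
  by case: ux => ux; apply: (quotient_black qf); rewrite ux //;
    move: adjv; rewrite xy orbb.
move=> u v; case: (mergeP f x y u) => [ux|ux uy]; case: (mergeP f x y v) =>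
  [vx|vx vy].
- by rewrite tadj_irr.
- exact: main.
- by rewrite e_sym tadj_sym tred_sym; apply: main.
by rewrite contract_adj_old // contract_red_old // uy vy; apply: quotient_black.
Qed.

Definition deg2 H := forall u, #|rnbr H u| <= 2.

Lemma deg2_uniq H u a b c : deg2 H -> tred H u a -> tred H u b ->
  tred H u c -> uniq [:: a; b; c] -> False.
Proof.
move=> dH ua ub uc abc; have := dH u; rewrite leqNgt => /negP; apply.
suff: size [:: a; b; c] <= #|rnbr H u| by [].
rewrite -(card_uniqP abc); apply/subset_leq_card/subsetP => w.
by rewrite !inE => /or3P[] /eqP->.
Qed.

Lemma common_nbrI f H c d u v : quotient f H -> f u = c -> f v = d ->
  c != d -> ~~ tred H c d -> e u v -> u \in common_nbr (part f d).
Proof. by move=> qf <- <-; apply: quotient_common. Qed.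

(* [X] separates the part of [a0] from the part of [a3], except for the edges
   joining these two parts to each other; [Z] is the side of [a0]. *)
Definition separated f a0 a1 a2 a3 := exists X Z : {set T},
  [/\ #|X| <= 3 * t,
      common_nbr (part f a1) :|: common_nbr (part f a2) \subset X,
      forall u, f u = a0 -> u \in Z,
      forall u, f u = a3 -> u \notin Z
    & forall u v, u \in Z -> v \notin Z -> e u v -> u \notin X ->
        v \notin X -> f u \in [:: a0; a1; a2; a3] ->
        f v \in [:: a0; a1; a2; a3] ->
        (f u \in [:: a1; a2]) || (f v \in [:: a1; a2]) -> False].

Lemma separated_sym f a0 a1 a2 a3 :
  separated f a0 a1 a2 a3 -> separated f a3 a2 a1 a0.
Proof.
case=> X [Z [X3 KX Z0 Z3 cl]]; exists X, (~: Z); split=> //.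
- by rewrite setUC.
- by move=> u /Z3; rewrite inE.
- by move=> u /Z0; rewrite inE => ->.
have rev4 w : (w \in [:: a3; a2; a1; a0]) = (w \in [:: a0; a1; a2; a3]).
  by rewrite -[RHS]mem_rev.
have rev2 w : (w \in [:: a2; a1]) = (w \in [:: a1; a2]).
  by rewrite -[RHS]mem_rev.
move=> u v; rewrite !in_setC negbK !rev4 !rev2 e_sym => uZ vZ euv uX vX.
by move=> u4 v4 uv; apply: (cl v u) => //; rewrite orbC.
Qed.

(** The invariant carried along the contraction sequence. Bigness is asked of the inner parts only,
    since only their common neighbours have to be paid for. *)
Definition chains f H := forall a0 a1 a2 a3, uniq [:: a0; a1; a2; a3] ->
  tred H a0 a1 -> tred H a1 a2 -> tred H a2 a3 ->
  t <= #|part f a1| -> t <= #|part f a2| -> separated f a0 a1 a2 a3.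

(** A contraction is asymmetric, because the new vertex reuses the name [x], but the case analyses
    are not: here [z] and [z'] are the two contracted vertices in either order. Red edges at [x] are
    described in one direction only, as further ones arise from disagreeing adjacencies. *)
Record splits f H f' H' x z z' : Prop := Splits {
  splits_neq : z != z';
  splits_part : part f' x = part f z :|: part f z';
  splits_old : forall w, w \notin [:: z; z'] -> part f' w = part f w;
  splits_red_new : forall w, w \notin [:: z; z'] ->
    tred H z w || tred H z' w -> tred H' x w;
  splits_red_old : forall v w, v \notin [:: z; z'] -> w \notin [:: z; z'] ->
    tred H' v w = tred H v w
}.

Lemma splits_sym f H f' H' x z z' :
  splits f H f' H' x z z' -> splits f H f' H' x z' z.
Proof.
have rev2 w : (w \in [:: z'; z]) = (w \in [:: z; z']).
  by rewrite -[RHS]mem_rev.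
case=> *; split; rewrite ?rev2 1?eq_sym 1?setUC //.
- by move=> w; rewrite rev2; auto.
- by move=> w; rewrite rev2 orbC; auto.
by move=> v w; rewrite !rev2; auto.
Qed.

Lemma splits_contract f H x y : x != y ->
  splits f H (merge f x y) (contract H x y) x x y.
Proof.
move=> nxy; split; rewrite ?inE ?eqxx //.
- apply/setP => u; rewrite !inE /merge.
  by case: (eqVneq (f u) y) => _; rewrite ?eqxx ?orbF ?orbT.
- move=> w; rewrite !inE negb_or => /andP[wx wy]; apply/setP => u.
  rewrite !inE /merge; have [->|//] := eqVneq (f u) y.
  by rewrite eq_sym (negPf wx) eq_sym (negPf wy).
- move=> w; rewrite !inE negb_or contract_red_new => /andP[-> ->] /=.
  by rewrite orbA => ->.
move=> v w; rewrite !inE !negb_or => /andP[vx vy] /andP[wx wy].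
by rewrite contract_red_old // vy wy.
Qed.

(** * The effect of one contraction on the separators of red paths *)

Section Split.
Variables (f f' : T -> T) (H H' : trigraph T) (x z z' : T).
Hypotheses (qf : quotient f H) (qf' : quotient f' H').
Hypotheses (dH : deg2 H) (dH' : deg2 H').
Hypotheses (fH : chains f H) (sp : splits f H f' H' x z z').

Lemma splits_val u w : w \notin [:: z; z'] -> (f' u == w) = (f u == w).
Proof. by move/(splits_old sp)/setP/(_ u); rewrite !inE. Qed.

Lemma splits_valx u : (f' u == x) = (f u == z) || (f u == z').
Proof. by have /setP/(_ u) := splits_part sp; rewrite !inE. Qed.

Lemma card_commonU (A B Y : {set T}) : t <= #|A| -> t <= #|B| -> #|Y| <= t ->
  #|common_nbr A :|: common_nbr B :|: Y| <= 3 * t.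
Proof.
move=> /common_nbr_card cA /common_nbr_card cB cY.
have := cardsU (common_nbr A :|: common_nbr B) Y.
by have := cardsU (common_nbr A) (common_nbr B); lia.
Qed.

(** A vertex among [z], [z'] without a red edge to [a1] in [H] reaches that part by black edges
    only, which [common_nbr (part f' a1)] stops. If this holds for both, the common neighbours of
    [a1] and [a2] suffice. Otherwise [z] starts a red path that [H] already had; its separator is
    kept, and the part of [z'] is added to the side of [z]. *)
Lemma chain_split_end a1 a2 a3 : uniq [:: x; a1; a2; a3] ->
  [&& a1 \notin [:: z; z'], a2 \notin [:: z; z'] & a3 \notin [:: z; z']] ->
  tred H' x a1 -> tred H' a1 a2 -> tred H' a2 a3 ->
  t <= #|part f' a1| -> t <= #|part f' a2| -> ~~ tred H z' a1 ->
  separated f' x a1 a2 a3.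
Proof.
move=> Ux /and3P[a1z a2z a3z] xa1 a12 a23 big1 big2 z'a1.
move: (Ux); rewrite /= !inE !negb_or andbT -!andbA.
case/and5P=> x1 x2 x3 n12 /andP[n13 n23].
have rx2 : ~~ tred H' x a2.
  apply/negP => xa2; apply: (deg2_uniq (a := a1) (b := a3) (c := x) dH').
  - by rewrite tred_sym; apply: a12.
  - exact: a23.
  - by rewrite tred_sym.
  by rewrite /= !inE negb_or n13 eq_sym x1 eq_sym x3.
have kill2 u v : f' u = x -> f' v = a2 -> e u v ->
    u \in common_nbr (part f' a2).
  by move=> ux va2; apply: (common_nbrI qf' ux va2).
have kill1 y u v : ~~ tred H y a1 -> y \in [:: z; z'] -> f u = y -> f' v = a1 ->
    e u v -> u \in common_nbr (part f' a1).
  rewrite (splits_old sp) // => ya1 yz uy /eqP.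
  rewrite splits_val // => /eqP va1; apply: (common_nbrI qf uy va1) => //.
  by apply: contraNneq a1z => <-.
have xa : x \notin [:: a1; a2] by rewrite !inE negb_or x1.
have [za1|za1] := boolP (tred H z a1); last first.
  exists (common_nbr (part f' a1) :|: common_nbr (part f' a2) :|: set0).
  exists (part f' x); split.
  - by rewrite card_commonU ?cards0.
  - by rewrite subsetUl.
  - by move=> u; rewrite inE => ->.
  - by move=> u; rewrite inE => ->; rewrite eq_sym.
  move=> u v; rewrite inE => /eqP ux _ euv.
  rewrite setU0 inE negb_or => /andP[/negP uX1 /negP uX2] _ _ _.
  rewrite ux (negPf xa) !inE /= => /orP[]/eqP va; last first.
    exact: uX2 (kill2 _ _ ux va euv).
  move/eqP: ux; rewrite splits_valx => /orP[]/eqP uz; apply: uX1.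
    by apply: kill1 za1 _ uz va euv; rewrite inE eqxx.
  by apply: kill1 z'a1 _ uz va euv; rewrite !inE eqxx orbT.
case: (fH (a0 := z) (a1 := a1) (a2 := a2) (a3 := a3)).
- move: a1z a2z a3z; rewrite /= !inE !negb_or !(eq_sym z) n12 n13 n23.
  by move=> /andP[-> _] /andP[-> _] /andP[-> _].
- exact: za1.
- by rewrite -(splits_red_old sp).
- by rewrite -(splits_red_old sp).
- by rewrite -(splits_old sp).
- by rewrite -(splits_old sp).
move=> X [Z [X3 KX Z0 Z3 cl]]; exists X, (Z :|: part f z'); split=> //.
- by rewrite !(splits_old sp).
- move=> u /eqP; rewrite splits_valx inE => /orP[]/eqP uz.
    by rewrite Z0.
  by rewrite inE uz eqxx orbT.
- move=> u /eqP; rewrite splits_val // => /eqP u3; rewrite !inE negb_or Z3 //=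
    u3.
  by apply: contraNneq a3z => <-; rewrite !inE eqxx orbT.
move=> u v uZ; rewrite in_setU negb_or [v \in part _ _]inE => /andP[vZ vz'] euv
  uX vX u4 v4.
have mem4 w : f w != z' -> f' w \in [:: x; a1; a2; a3] ->
    f w \in [:: z; a1; a2; a3].
  by rewrite !inE splits_valx !splits_val // => /negPf->; rewrite orbF.
have memi w : (f' w \in [:: a1; a2]) = (f w \in [:: a1; a2]).
  by rewrite !inE !splits_val.
have [uz'|uz'] := eqVneq (f u) z'; last first.
  rewrite !memi; apply: cl; rewrite ?mem4 //.
  by move: uZ; rewrite !inE (negPf uz') orbF.
have ux : f' u = x by apply/eqP; rewrite splits_valx uz' eqxx orbT.
rewrite ux (negPf xa) !inE /= => va.
have : u \in common_nbr (part f' a1) :|: common_nbr (part f' a2).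
  rewrite inE; case/orP: va => /eqP va; last by rewrite (kill2 u v) ?orbT.
  by rewrite (kill1 z' u v) // !inE eqxx orbT.
rewrite !(splits_old sp) // => /(subsetP KX); exact/negP.
Qed.

(** The cut may have to run inside the new part, between the parts of [z] and [z']. Where it runs
    depends on which red edges [z] had in [H]. *)
Lemma chain_split_mid a0 a2 a3 : uniq [:: a0; x; a2; a3] ->
  [&& a0 \notin [:: z; z'], a2 \notin [:: z; z'] & a3 \notin [:: z; z']] ->
  tred H' a0 x -> tred H' x a2 -> tred H' a2 a3 ->
  t <= #|part f' x| -> t <= #|part f' a2| -> ~~ tred H z' a2 ->
  separated f' a0 x a2 a3.
Proof.
move=> Ux /and3P[a0z a2z a3z] a0x xa2 a23 bigx big2 z'a2.
move: (Ux); rewrite /= !inE !negb_or andbT -!andbA.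
case/and5P=> n0x n02 n03 nx2 /andP[nx3 n23].
have nz : z != z' := splits_neq sp.
have zin : z \in [:: z; z'] by rewrite inE eqxx.
have z'in : z' \in [:: z; z'] by rewrite !inE eqxx orbT.
have az a y : a \notin [:: z; z'] -> y \in [:: z; z'] -> a != y.
  by move=> /[swap] yin; apply: contraNneq => ->.
have rx3 : ~~ tred H' x a3.
  apply/negP => xa3; apply: (deg2_uniq (a := a0) (b := a2) (c := a3) dH').
  - by rewrite tred_sym; apply: a0x.
  - exact: xa2.
  - exact: xa3.
  by rewrite /= !inE negb_or n02 n03 n23.
have r02 : ~~ tred H' a0 a2.
  apply/negP => a02; apply: (deg2_uniq (a := a0) (b := x) (c := a3) dH').
  - by rewrite tred_sym; apply: a02.
  - by rewrite tred_sym; apply: xa2.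
  - exact: a23.
  by rewrite /= !inE negb_or n0x n03 nx3.
have kill02 u v : f' u = a0 -> f' v = a2 -> e u v ->
    u \in common_nbr (part f' a2).
  by move=> u0 v2; apply: (common_nbrI qf' u0 v2).
have kill3x u v : f' u = x -> f' v = a3 -> e u v ->
    v \in common_nbr (part f' x).
  move=> ux v3; rewrite e_sym; apply: (common_nbrI qf' v3 ux).
    by rewrite eq_sym.
  by rewrite tred_sym.
have kill2 y u v : ~~ tred H y a2 -> y \in [:: z; z'] -> f u = y -> f' v = a2 ->
    e u v -> u \in common_nbr (part f' a2).
  rewrite (splits_old sp) // => ya2 yz uy /eqP.
  rewrite splits_val // => /eqP va2; apply: (common_nbrI qf uy va2) => //.
  by rewrite eq_sym az.
have a0i : a0 \notin [:: x; a2] by rewrite !inE negb_or n0x.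
have n3x : (a3 == x) = false by rewrite eq_sym (negPf nx3).
have n32 : (a3 == a2) = false by rewrite eq_sym (negPf n23).
have a3i : a3 \notin [:: x; a2].
  by rewrite !inE negb_or ![a3 == _]eq_sym nx3 n23.
(* The cut just behind the part of [x]. It works if at most [t] vertices of this part could leave it
   along a red edge of [H] to [a2]; [Y] collects them. *)
have triv (Y : {set T}) : #|Y| <= t ->
    (forall u, f u = z -> tred H z a2 -> u \in Y) -> separated f' a0 x a2 a3.
  move=> Yt YP.
  exists (common_nbr (part f' x) :|: common_nbr (part f' a2) :|: Y).
  exists (part f' a0 :|: part f' x); split.
  - exact: card_commonU.
  - by rewrite subsetUl.
  - by move=> u; rewrite !inE => ->; rewrite eqxx.
  - by move=> u; rewrite !inE => ->; rewrite ![a3 == _]eq_sym negb_or n03.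
  move=> u v; rewrite !in_setU !negb_or !in_part => u01 /andP[v0 v1] euv.
  case/andP=> /andP[/negP uX1 /negP uX2 /negP uY].
  case/andP=> /andP[/negP vX1 /negP vX2 /negP vY] _.
  rewrite !inE (negPf v0) (negPf v1) /= => /orP[/eqP v2 _|/eqP v3].
    case/orP: u01 => [/eqP u0|]; first by apply: uX2; apply: (kill02 u v).
    rewrite splits_valx => /orP[]/eqP uz; last by apply: uX2; apply: (kill2 z' u
      v).
    have [za2|za2] := boolP (tred H z a2); first by apply: uY; apply: YP.
    by apply: uX2; apply: (kill2 z u v).
  case/orP: u01 => [/eqP u0|/eqP ux _]; last by apply: vX1; apply: (kill3x u v).
  by rewrite u0 v3 (negPf n0x) (negPf n02) n32.
have [za2|za2] := boolP (tred H z a2); last first.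
  by apply: (triv set0); rewrite ?cards0 //= => u _; rewrite (negPf za2).
have [smallz|bigz] := leqP #|part f z| t.
  by apply: (triv (part f z)) => // u uz _; rewrite inE uz.
(* A larger part has fewer common neighbours, so a separator built for [z] also stops the edges
   between [x] and [a3]. *)
have Kxz : common_nbr (part f' x) \subset common_nbr (part f z).
  by apply: common_nbrS; rewrite (splits_part sp) subsetUl.
have memx w : f' w = x -> f w != z' -> f w = z.
  by move=> /eqP; rewrite splits_valx => /orP[]/eqP-> //; rewrite eqxx.
have killz y u v : ~~ tred H y z -> y != z -> f u = y -> f v = z -> e u v ->
    u \in common_nbr (part f z).
  by move=> yz nyz uy vz; apply: (common_nbrI qf uy vz).
(* First position of the cut: [a0 z a2 a3] was a red path of [H]. Then [z] has no room for a red
   edge to [z'], whose part can join the side of [a0]. *)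
have [za0|za0] := boolP (tred H z a0).
  have z'z : ~~ tred H z' z.
    apply/negP => z'z; apply: (deg2_uniq (a := a0) (b := a2) (c := z') dH).
    - exact: za0.
    - exact: za2.
    - by rewrite tred_sym.
    by rewrite /= !inE negb_or n02 !az.
  case: (fH (a0 := a0) (a1 := z) (a2 := a2) (a3 := a3)).
  - by rewrite /= !inE !negb_or n02 n03 n23 ![z == _]eq_sym !az.
  - by rewrite tred_sym.
  - exact: za2.
  - by rewrite -(splits_red_old sp).
  - exact: ltnW.
  - by rewrite -(splits_old sp).
  move=> X [Z [X3 KX Z0 Z3 cl]]; exists X, (Z :|: part f z'); split=> //.
  - by apply: subset_trans KX; rewrite (splits_old sp a2z) setSU.
  - by move=> u /eqP; rewrite splits_val // => /eqP/Z0; rewrite inE => ->.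
  - move=> u /eqP; rewrite splits_val // => /eqP u3.
    by rewrite !inE negb_or Z3 //= u3 az.
  move=> u v; rewrite !in_setU negb_or !in_part => uZ /andP[vZ vz'] euv.
  move=> /negP uX /negP vX.
  have KXz w : w \in common_nbr (part f z) -> w \in X.
    by move=> wK; apply: (subsetP KX); rewrite in_setU wK.
  have KX2 w : w \in common_nbr (part f' a2) -> w \in X.
    by rewrite (splits_old sp) // => wK; apply: (subsetP KX);
      rewrite in_setU wK orbT.
  have [uz'|uz'] := eqVneq (f u) z'.
    have ux : f' u = x by apply/eqP; rewrite splits_valx uz' eqxx orbT.
    move=> _; rewrite !inE => /or4P[]/eqP vE _.
    - by move/eqP: vE; rewrite splits_val // => /eqP/Z0; rewrite (negPf vZ).
    - by apply: uX; apply: KXz; apply: (killz z' u v); rewrite 1?eq_sym //;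
        apply: memx.
    - by apply: uX; apply: KX2; apply: (kill2 z' u v).
    - by apply: vX; apply: KXz; apply: (subsetP Kxz); apply: (kill3x u v).
  move: uZ; rewrite (negPf uz') orbF => uZ; rewrite !inE !splits_valx.
  rewrite !splits_val // (negPf uz') (negPf vz') !orbF => u4 v4 uv.
  by apply: (cl u v) => //; rewrite ?inE //; apply/negP.
(* Second position: [z' z a2 a3] was a red path of [H]. The part of [a0], which is not red to [z],
   joins the side of [z']. *)
have [z'z|z'z] := boolP (tred H z' z).
  case: (fH (a0 := z') (a1 := z) (a2 := a2) (a3 := a3)).
  - rewrite /= !inE !negb_or n23 ![z == _]eq_sym ![z' == _]eq_sym.
    by rewrite nz !az.
  - exact: z'z.
  - exact: za2.
  - by rewrite -(splits_red_old sp).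
  - exact: ltnW.
  - by rewrite -(splits_old sp).
  move=> X [Z [X3 KX Z0 Z3 cl]]; exists X, (Z :|: part f' a0); split=> //.
  - by apply: subset_trans KX; rewrite (splits_old sp a2z) setSU.
  - by move=> u u0; rewrite !inE u0 eqxx orbT.
  - move=> u u3; rewrite !inE negb_or u3 eq_sym n03 andbT.
    by apply: Z3; apply/eqP; rewrite -splits_val ?u3.
  move=> u v; rewrite !in_setU negb_or !in_part => uZ /andP[vZ v0] euv.
  move=> /negP uX /negP vX.
  have KXz w : w \in common_nbr (part f z) -> w \in X.
    by move=> wK; apply: (subsetP KX); rewrite in_setU wK.
  have KX2 w : w \in common_nbr (part f' a2) -> w \in X.
    by rewrite (splits_old sp) // => wK; apply: (subsetP KX);
      rewrite in_setU wK orbT.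
  have vz' : f v != z' by apply: contraNneq vZ => /Z0.
  have [u0|u0] := eqVneq (f' u) a0.
    move=> _; rewrite !inE (negPf v0) u0 /= => /or3P[]/eqP vE.
    - move=> _; apply: uX; apply: KXz; apply: (killz a0 u v) => //.
      + by rewrite tred_sym.
      + exact: az.
      + by apply/eqP; rewrite -splits_val // u0.
      exact: memx.
    - by move=> _; apply: uX; apply: KX2; apply: (kill02 u v).
    by rewrite vE (negPf n0x) (negPf n02) n3x n32.
  move: uZ; rewrite (negPf u0) orbF => uZ.
  rewrite !inE (negPf u0) (negPf v0) /= => u3 v3 uv.
  have [/eqP fv3|nv3] := boolP (f' v == a3).
    have [/eqP ux|nux] := boolP (f' u == x).
      by apply: vX; apply: KXz; apply: (subsetP Kxz); apply: (kill3x u v).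
    move: uv u3; rewrite (negPf nux) fv3 n3x n32 /= !orbF => u2 _.
    have fv3' : f v == a3 by rewrite -splits_val // fv3.
    apply: (cl u v) => //; rewrite ?inE -?(splits_val u a2z) ?u2 ?fv3' ?orbT //;
      exact/negP.
  apply: (cl u v) => //; try exact/negP.
  - move: u3; rewrite splits_valx !splits_val // !inE.
    by case: (f u == z); case: (f u == z').
  - move: v3; rewrite splits_valx !splits_val // !inE (negPf vz').
    by case: (f v == z).
  move: v3; rewrite (negPf nv3) orbF splits_valx (negPf vz') orbF.
  by rewrite splits_val // !inE => ->; rewrite orbT.
(* Third position: [z] is red to neither [a0] nor [z'], so the cut is made in front of [z], which
   stays on the side of [a3]. *)
exists (common_nbr (part f z) :|: common_nbr (part f' a2) :|: set0).
exists (part f' a0 :|: part f z'); split.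
- by apply: card_commonU; rewrite ?cards0 // ltnW.
- by rewrite setU0 setSU.
- by move=> u; rewrite !inE => ->; rewrite eqxx.
- move=> u u3; rewrite !inE negb_or u3 eq_sym n03 /=.
  have /eqP-> : f u == a3 by rewrite -splits_val // u3.
  exact: az.
move=> u v; rewrite !in_setU !negb_or !in_part => u01 /andP[v0 vz'] euv.
case/andP=> /andP[/negP uX1 /negP uX2 _].
case/andP=> /andP[/negP vX1 /negP vX2 _].
case/orP: u01 => [/eqP u0|/eqP uz'] _; rewrite inE (negPf v0) /= !inE.
  case/or3P=> /eqP vE.
  - move=> _; apply: uX1; apply: (killz a0 u v) => //.
    + by rewrite tred_sym.
    + exact: az.
    + by apply/eqP; rewrite -splits_val // u0.
    exact: memx.
  - by move=> _; apply: uX2; apply: (kill02 u v).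
  by rewrite vE u0 (negPf n0x) (negPf n02)
      n3x n32.
case/or3P=> /eqP vE _.
- by apply: uX1; apply: (killz z' u v) => //; rewrite 1?eq_sym //; apply: memx.
- by apply: uX2; apply: (kill2 z' u v).
apply: vX1; apply: (subsetP Kxz); apply: (kill3x u v) => //.
by apply/eqP; rewrite splits_valx uz' eqxx orbT.
Qed.

End Split.

(** A path that avoids [x] was already red in [H], with the same parts. Otherwise, up to reversal,
    [x] is the end of the path or its second vertex. *)
Lemma chains_contract f H x y : x != y -> x \in tvert H -> y \in tvert H ->
  quotient f H -> deg2 H -> deg2 (contract H x y) -> chains f H ->
  chains (merge f x y) (contract H x y).
Proof.
move=> nxy xH yH qf dH dH' fH.
have qf' := quotient_contract nxy xH yH qf.
set f' := merge f x y in qf' *; set H' := contract H x y in qf' dH' *.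
have sp : splits f H f' H' x x y := splits_contract f H nxy.
have ny v w : tred H' v w -> v != y.
  by move/tred_vert; rewrite in_contract_vert // => /andP[].
have nin v w : v != x -> tred H' v w -> v \notin [:: x; y].
  by move=> vx /ny vy; rewrite !inE negb_or vx.
have rev v w : tred H' v w -> tred H' w v by rewrite tred_sym.
(* With [b], [x] and [y], the vertex [a] would have three red neighbours in [H]. This decides which
   of [x] and [y] plays the role of [z']. *)
have pick1 a b : a \notin [:: x; y] -> b \notin [:: x; y] -> tred H' a b ->
    tred H x a -> ~~ tred H y a.
  move=> ax bx ab xa; apply/negP => ya.
  apply: (deg2_uniq (a := x) (b := y) (c := b) dH).
  - by rewrite tred_sym; apply: xa.
  - by rewrite tred_sym.
  - by rewrite -(splits_red_old sp); first apply: ab.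
  by move: bx; rewrite /= !inE !negb_or ![b == _]eq_sym nxy => /andP[-> ->].
have endc a1 a2 a3 : uniq [:: x; a1; a2; a3] ->
    tred H' x a1 -> tred H' a1 a2 -> tred H' a2 a3 ->
    t <= #|part f' a1| -> t <= #|part f' a2| -> separated f' x a1 a2 a3.
  move=> Ux r1 r2 r3 b1 b2; move: (Ux) => /= /andP[+ _].
  rewrite !inE !negb_or ![x == _]eq_sym => /and3P[x1 x2 x3].
  have n1 := nin _ _ x1 r2; have n2 := nin _ _ x2 r3.
  have n3 := nin _ _ x3 (rev _ _ r3).
  have [xa|xa] := boolP (tred H x a1).
    have ya := pick1 _ _ n1 n2 r2 xa.
    by apply: (chain_split_end qf qf' dH' fH sp) => //; apply/and3P.
  have n12 v : (v \notin [:: y; x]) = (v \notin [:: x; y]).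
    by rewrite -mem_rev.
  by apply: (chain_split_end qf qf' dH' fH (splits_sym sp));
    rewrite ?n12 //; apply/and3P.
have midc a0 a2 a3 : uniq [:: a0; x; a2; a3] ->
    tred H' a0 x -> tred H' x a2 -> tred H' a2 a3 ->
    t <= #|part f' x| -> t <= #|part f' a2| -> separated f' a0 x a2 a3.
  move=> Ux r1 r2 r3 b1 b2.
  move: (Ux); rewrite /= !inE !negb_or -!andbA ![x == _]eq_sym.
  case/and5P=> x0 _ _ x2 /andP[x3 _].
  have n0 := nin _ _ x0 r1; have n2 := nin _ _ x2 r3.
  have n3 := nin _ _ x3 (rev _ _ r3).
  have [xa|xa] := boolP (tred H x a2).
    have ya := pick1 _ _ n2 n3 r3 xa.
    by apply: (chain_split_mid qf qf' dH dH' fH sp) => //; apply/and3P.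
  have n12 v : (v \notin [:: y; x]) = (v \notin [:: x; y]).
    by rewrite -mem_rev.
  by apply: (chain_split_mid qf qf' dH dH' fH (splits_sym sp));
    rewrite ?n12 //; apply/and3P.
move=> a0 a1 a2 a3 U r1 r2 r3 b1 b2.
have Urev : uniq [:: a3; a2; a1; a0] by rewrite -rev_uniq.
have [E|x0] := eqVneq a0 x; first by rewrite -E in endc; apply: endc.
have [E|x1] := eqVneq a1 x; first by rewrite -E in midc; apply: midc.
have [E|x2] := eqVneq a2 x.
  by rewrite -E in midc; apply/separated_sym/midc => //; apply: rev.
have [E|x3] := eqVneq a3 x.
  by rewrite -E in endc; apply/separated_sym/endc => //; apply: rev.
have n0 := nin _ _ x0 r1; have n1 := nin _ _ x1 r2; have n2 := nin _ _ x2 r3.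
have n3 := nin _ _ x3 (rev _ _ r3).
case: (fH a0 a1 a2 a3); rewrite -?(splits_red_old sp) -?(splits_old sp) //.
have val u a : a \notin [:: x; y] -> (f' u == a) = (f u == a).
  exact: (splits_val sp).
move=> X [Z [X3 KX Z0 Z3 cl]]; exists X, Z; split=> //.
- by move=> u /eqP; rewrite val // => /eqP; apply: Z0.
- by move=> u /eqP; rewrite val // => /eqP; apply: Z3.
move=> u v uZ vZ euv uX vX; rewrite !inE !val // => u4 v4 uv.
by apply: (cl u v); rewrite ?inE.
Qed.

(* [Z] is what can be reached from the part of [a0] outside [X], if the first
   step out of this part goes to the part of [a1]. *)
Definition half_separated f H a0 a1 := exists (X Z : {set T}) (c1 c2 : T),
  [/\ #|X| <= 3 * t, part f a0 \subset Z,
      Z \subset part f a0 :|: part f c1 :|: part f c2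
    & forall u v, u \in Z -> e u v -> u \notin X -> v \notin X ->
        (f u != a0) || (f v == a1) -> v \in Z].

(** The witness is the dummy value [a] if [u] has no second red neighbour; this is why later case
    distinctions test again whether the edge is red. *)
Lemma deg2_other H u a : deg2 H -> tred H u a ->
  exists b, forall w, tred H u w -> w != a -> w = b.
Proof.
move=> dH ua; have [b /andP[ub ba]|none] := pickP [pred w | tred H u w & w !=
  a].
  exists b => w uw wa; apply/eqP/negP => wb; apply: (deg2_uniq dH ua ub uw).
  by rewrite /= !inE negb_or ![a == _]eq_sym ba wa eq_sym; case: eqP wb.
by exists a => w uw wa; have := none w; rewrite /= uw wa.
Qed.

(** Red edges are followed away from [a0]. A part with at most [t] vertices is put into [X]
    entirely, and where the red path ends common neighbours suffice. If neither happens at [a1] or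
    [a2], both are big and [chains] provides the cut. *)
Lemma half_separatedP f H a0 a1 : quotient f H -> deg2 H -> chains f H ->
  tred H a0 a1 -> half_separated f H a0 a1.
Proof.
move=> qf dH fH r01; have r10 : tred H a1 a0 by rewrite tred_sym.
have n01 : a0 != a1 by apply: contraTneq r01 => ->; rewrite tred_irr.
have t3 : t <= 3 * t by rewrite leq_pmull.
have kill u v : f u != f v -> ~~ tred H (f u) (f v) -> e u v ->
    v \in common_nbr (part f (f u)).
  by move=> nuv ruv euv; apply: (quotient_common qf);
    rewrite 1?eq_sym 1?tred_sym 1?e_sym.
have [small1|big1] := leqP #|part f a1| t.
  exists (part f a1), (part f a0), a0, a0; split=> //.
  - exact: leq_trans t3.
  - by rewrite !setUid.
  by move=> u v; rewrite !in_part => -> _ _ /negPf->.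
have [a2 oth1] := deg2_other dH r10.
have c1 := common_nbr_card (ltnW big1).
have step1 X (Z : {set T}) u v : common_nbr (part f a1) \subset X ->
    part f a1 \subset Z -> f u = a1 -> e u v -> v \notin X ->
    v \in Z \/ tred H a1 (f v).
  move=> KX aZ u1 euv vX; have [vu|nuv] := eqVneq (f v) a1.
    by left; apply: (subsetP aZ); rewrite in_part vu.
  right; apply: contraNT vX => ruv; apply: (subsetP KX).
  by rewrite -u1; apply: kill => //; rewrite u1 // eq_sym.
have [r12|r12] := boolP (tred H a1 a2 && (a2 != a0)); last first.
  exists (common_nbr (part f a1)), (part f a0 :|: part f a1), a1, a1; split.
  - exact: leq_trans t3.
  - by rewrite subsetUl.
  - by rewrite -setUA setUid.
  move=> u v; rewrite !in_setU !in_part => u01 euv _ vX uv.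
  have [u1|u1] := eqVneq (f u) a1; last first.
    by move: u01 uv; rewrite (negPf u1) orbF => -> /= ->; rewrite orbT.
  have := step1 _ (part f a0 :|: part f a1) _ _ (subxx _) (subsetUr _ _) u1 euv
    vX.
  rewrite in_setU !in_part => -[//|r1v].
  have [//|v0] := eqVneq (f v) a0.
  by move: r12; rewrite -(oth1 _ r1v v0) r1v v0.
case/andP: r12 => r12 n20; have r21 : tred H a2 a1 by rewrite tred_sym.
have n12 : a1 != a2 by apply: contraTneq r12 => ->; rewrite tred_irr.
have [small2|big2] := leqP #|part f a2| t.
  exists (common_nbr (part f a1) :|: part f a2).
  exists (part f a0 :|: part f a1), a1, a1; split.
  - by have := cardsU (common_nbr (part f a1)) (part f a2); lia.
  - by rewrite subsetUl.
  - by rewrite -setUA setUid.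
  move=> u v; rewrite !in_setU !in_part => u01 euv _ vX uv.
  have [u1|u1] := eqVneq (f u) a1; last first.
    by move: u01 uv; rewrite (negPf u1) orbF => -> /= ->; rewrite orbT.
  case/norP: vX => vX v2.
  have := step1 _ (part f a0 :|: part f a1) _ _ (subxx _) (subsetUr _ _) u1 euv
    vX.
  rewrite in_setU !in_part => -[//|r1v].
  have [//|v0] := eqVneq (f v) a0.
  by move: v2; rewrite (oth1 _ r1v v0) eqxx.
have c2 := common_nbr_card (ltnW big2).
have [a3 oth2] := deg2_other dH r21.
(* The negative case comprises a path ending at [a2] and a red triangle [a0 a1 a2]. In both, no red
   edge from [a1] or [a2] leaves the three parts. *)
have [r23|r23] := boolP [&& tred H a2 a3, a3 != a1 & a3 != a0]; last first.
  exists (common_nbr (part f a1) :|: common_nbr (part f a2)).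
  exists (part f a0 :|: part f a1 :|: part f a2), a1, a2; split=> //.
  - have := cardsU (common_nbr (part f a1)) (common_nbr (part f a2)); lia.
  - by rewrite -setUA subsetUl.
  move=> u v; rewrite !in_setU !in_part => u012 euv _.
  rewrite negb_or => /andP[vX1 vX2] uv.
  have [/eqP u1|u1] := boolP (f u == a1).
    have aZ : part f a1 \subset part f a0 :|: part f a1 :|: part f a2.
      by rewrite -setUA setUCA subsetUl.
    case: (step1 _ _ _ _ (subxx _) aZ u1 euv vX1).
      by rewrite !in_setU !in_part.
    move=> r1v; have [//|v0] := eqVneq (f v) a0.
    by rewrite (oth1 _ r1v v0) eqxx !orbT.
  have [/eqP u2|u2] := boolP (f u == a2); last first.
    move: u012 uv; rewrite (negPf u1) (negPf u2) !orbF => -> /= ->.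
    by rewrite orbT.
  have [//|nv2] := eqVneq (f v) a2; first by rewrite !orbT.
  have [r2v|r2v] := boolP (tred H a2 (f v)); last first.
    by case/negP: vX2; rewrite -u2; apply: kill => //; rewrite u2 // eq_sym.
  have [//|v1] := eqVneq (f v) a1; first by rewrite orbT.
  have v3 := oth2 _ r2v v1; move: r23; rewrite -v3 r2v v1 /= negbK => ->.
  by [].
case/and3P: r23 => r23 n31 n30.
case: (fH a0 a1 a2 a3); rewrite ?(ltnW big1) ?(ltnW big2) //.
  rewrite /= !inE !negb_or n01 n12 /= ![a0 == _]eq_sym n20 n30.
  rewrite [a1 == _]eq_sym n31 /= andbT.
  by apply: contraTneq r23 => ->; rewrite tred_irr.
move=> X [Z [X3 KX Z0 Z3 cl]].
exists X, (Z :&: (part f a0 :|: part f a1 :|: part f a2)), a1, a2; split=> //.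
- apply/subsetP => u; rewrite !in_setI !in_setU !in_part => u0.
  by rewrite u0 andbT Z0 //; apply/eqP.
- exact: subsetIr.
move=> u v; rewrite !in_setI !in_setU !in_part => /andP[uZ u012] euv uX vX uv.
have KX1 w : w \in common_nbr (part f a1) -> w \in X.
  by move=> wK; apply: (subsetP KX); rewrite in_setU wK.
have KX2 w : w \in common_nbr (part f a2) -> w \in X.
  by move=> wK; apply: (subsetP KX); rewrite in_setU wK orbT.
have v4 : f v \in [:: a0; a1; a2; a3].
  have [/eqP u1|u1] := boolP (f u == a1).
    have [->|nv1] := eqVneq (f v) a1; first by rewrite !inE eqxx orbT.
    have [r1v|r1v] := boolP (tred H a1 (f v)); last first.
      case/negP: vX; apply: KX1; rewrite -u1.
      by apply: kill => //; rewrite u1 // eq_sym.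
    have [->|v0] := eqVneq (f v) a0; first by rewrite !inE eqxx.
    by rewrite (oth1 _ r1v v0) !inE eqxx !orbT.
  have [/eqP u2|u2] := boolP (f u == a2); last first.
    move: u012 uv; rewrite (negPf u1) (negPf u2) !orbF => -> /= /eqP->.
    by rewrite !inE eqxx orbT.
  have [->|nv2] := eqVneq (f v) a2; first by rewrite !inE eqxx !orbT.
  have [r2v|r2v] := boolP (tred H a2 (f v)); last first.
    case/negP: vX; apply: KX2; rewrite -u2.
    by apply: kill => //; rewrite u2 // eq_sym.
  have [->|v1] := eqVneq (f v) a1; first by rewrite !inE eqxx orbT.
  by rewrite (oth2 _ r2v v1) !inE eqxx !orbT.
have u4 : f u \in [:: a0; a1; a2; a3].
  by rewrite !inE; case/orP: u012 => [/orP[]|] ->; rewrite ?orbT.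
have vZ : v \in Z.
  apply/negPn/negP => vZ; apply: (cl u v) => //.
  move: u012 uv; rewrite !inE.
  by case: (f u == a1); case: (f u == a2); case: (f v == a1);
    case: (f u == a0).
rewrite vZ /=; move: v4; rewrite !inE => /or4P[->|->|->|/eqP/Z3];
  rewrite ?orbT //.
by rewrite vZ.
Qed.

(** The bound [7 * t] is [t] for the common neighbours of the part of [a0], which stop its black
    edges, plus [3 * t] for each of its at most two red edges. Each red edge brings in at most two
    further parts, whence [size c <= 4]. *)
Lemma exists_separation f H a0 : quotient f H -> deg2 H -> chains f H ->
  t <= #|part f a0| ->
  exists (X D : {set T}) (c : seq T),
    [/\ #|X| <= 7 * t, part f a0 \subset D :|: X, size c <= 4,
        forall u, u \in D -> (f u == a0) || (f u \in c)
      & [disjoint D & X] /\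
        forall u v, u \in D -> e u v -> v \in D :|: X].
Proof.
move=> qf dH fH big0.
have [b1 [b2 Hb]] : exists b1 b2, forall w, tred H a0 w -> w = b1 \/ w = b2.
  have [b1 r1|none] := pickP (tred H a0).
    have [b2 oth] := deg2_other dH r1; exists b1, b2 => w r0w.
    by have [->|nw] := eqVneq w b1; [left|right; apply: oth].
  by exists a0, a0 => w; rewrite none.
have half b : exists (X Z : {set T}) (c1 c2 : T),
  [/\ #|X| <= 3 * t, part f a0 \subset Z,
      Z \subset part f a0 :|: part f c1 :|: part f c2
    & forall u v, u \in Z -> e u v -> u \notin X -> v \notin X ->
        (f u != a0) || (tred H a0 b && (f v == b)) -> v \in Z].
  have [r0b|r0b] := boolP (tred H a0 b).
    by case: (half_separatedP qf dH fH r0b) => X [Z [c1 [c2 ?]]];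
      exists X, Z, c1, c2.
  exists set0, (part f a0), a0, a0; rewrite cards0 !setUid; split=> //.
  by move=> u v; rewrite !in_part => /eqP->; rewrite eqxx.
case: (half b1) => X1 [Z1 [c1 [c2 [X13 aZ1 Zc1 cl1]]]].
case: (half b2) => X2 [Z2 [c3 [c4 [X23 aZ2 Zc2 cl2]]]].
have c0 := common_nbr_card big0.
set X := common_nbr (part f a0) :|: X1 :|: X2.
have subX u : u \notin X -> (u \notin X1) && (u \notin X2).
  by rewrite !in_setU !negb_or -andbA => /and3P[_ -> ->].
exists X, ((Z1 :|: Z2) :\: X), [:: c1; c2; c3; c4]; split=> //.
- rewrite /X; have := cardsU (common_nbr (part f a0) :|: X1) X2.
  by have := cardsU (common_nbr (part f a0)) X1; lia.
- apply/subsetP => u /(subsetP aZ1) uZ; rewrite in_setU in_setD in_setU uZ /=.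
  by case: (u \in X).
- move=> u; rewrite in_setD in_setU => /andP[_ /orP[/(subsetP Zc1)|/(subsetP
    Zc2)]];
    rewrite !in_setU !in_part !inE => /orP[/orP[]|] ->; rewrite ?orbT //.
split; first by rewrite disjoints_subset setDE subsetIr.
move=> u v; rewrite in_setD in_setU => /andP[uX uZ] euv.
rewrite in_setU in_setD orbC; case: (boolP (v \in X)) => //= vX.
case/andP: (subX _ uX) => uX1 uX2; case/andP: (subX _ vX) => vX1 vX2.
rewrite in_setU.
have [u0|u0] := eqVneq (f u) a0; last first.
  by case/orP: uZ => uZ; apply/orP; [left; apply: cl1 uZ _ _ _ _|
    right; apply: cl2 uZ _ _ _ _]; rewrite ?u0.
have [v0|v0] := eqVneq (f v) a0.
  by rewrite (subsetP aZ1) // in_part v0.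
have [r0v|r0v] := boolP (tred H a0 (f v)); last first.
  case/negP: vX; rewrite !in_setU -u0 (quotient_common qf) //.
  - by rewrite u0.
  - by rewrite u0 tred_sym.
  by rewrite e_sym.
have [uZ1 uZ2] : u \in Z1 /\ u \in Z2.
  by split; [apply: (subsetP aZ1)|apply: (subsetP aZ2)]; rewrite in_part u0.
case: (Hb _ r0v) => vb; apply/orP.
  by left; apply: cl1 uZ1 euv _ _ _; rewrite // -vb r0v eqxx orbT.
by right; apply: cl2 uZ2 euv _ _ _; rewrite // -vb r0v eqxx orbT.
Qed.

Lemma deg2_width H : max_red_deg H <= 2 -> deg2 H.
Proof.
move=> H2 u; have [uH|uH] := boolP (u \in tvert H).
  exact: leq_trans (leq_bigmax_cond _ uH) H2.
rewrite (_ : rnbr H u = set0) ?cards0 //; apply/setP => v; rewrite !inE.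
by apply: contraNF uH; apply: tred_vert.
Qed.

Lemma card_in_parts f (c : seq T) (b : nat) A :
  (forall u, u \in A -> f u \in c) -> (forall a, #|A :&: part f a| <= b) ->
  #|A| <= size c * b.
Proof.
move=> Ac Ab; elim: c A Ac Ab => [|a c IHc] A Ac Ab /=.
  by rewrite leqn0 cards_eq0; apply/eqP/setP => u; rewrite inE;
    apply/negP => /Ac.
rewrite -(cardsID (part f a)) mulSn leq_add ?Ab //; apply: IHc.
  move=> u; rewrite in_setD in_part => /andP[ua /Ac].
  by rewrite inE (negPf ua).
by move=> b'; apply: leq_trans (Ab b'); rewrite subset_leq_card // setSI
  ?subsetDl.
Qed.

Definition separation (X D : {set T}) :=
  [disjoint D & X] /\ forall u v, u \in D -> e u v -> v \in D :|: X.

(** The last trigraph has a single part, so some contraction is the first to create a part with more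
    than [14 * t] vertices of [W]. At most [7 * t] of them are in [X], hence more than [7 * t] are
    in [D]. This part has at most [28 * t] of them, and [D] meets at most five parts, which gives
    [140 * t]. *)
Lemma balanced_separation (W : {set T}) f H s : 0 < t ->
  quotient f H -> chains f H -> contraction_seq H s -> width H s <= 2 ->
  (forall a, #|W :&: part f a| <= 14 * t) -> 14 * t < #|W| ->
  exists X D : {set T}, [/\ separation X D, #|X| <= 7 * t,
    7 * t < #|W :&: D| & #|W :&: D| <= 140 * t].
Proof.
move=> t0 + + + + + bigW; elim: s f H => [|[x y] s IHs] f H qf fH /=.
  move=> /cards1P[x Hx] _ /(_ x); rewrite leqNgt => /negP[].
  suff -> : W :&: part f x = W by [].
  apply/setIidPl/subsetP => u _; rewrite in_part.
  by have := quotient_vert qf u; rewrite Hx inE.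
case/and4P=> nxy xH yH sH'; rewrite geq_max => /andP[dH wH'] Wt.
have dH' : max_red_deg (contract H x y) <= 2.
  by apply: leq_trans wH'; case: (s) => [|[? ?] ?] /=; rewrite leq_maxl.
move/deg2_width in dH; move/deg2_width in dH'.
have qf' := quotient_contract nxy xH yH qf.
have fH' := chains_contract nxy xH yH qf dH dH' fH.
set f' := merge f x y in qf' fH'.
have W't a : a != x -> #|W :&: part f' a| <= 14 * t.
  move=> ax; apply: leq_trans (Wt a); apply/subset_leq_card/setIS/subsetP => u.
  rewrite !in_part /f' /merge; case: ifP => // _.
  by rewrite eq_sym (negPf ax).
have W'x : #|W :&: part f' x| <= 14 * t + 14 * t.
  apply: leq_trans (leq_add (Wt x) (Wt y)).
  rewrite (splits_part (splits_contract f H nxy)) setIUr.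
  exact: leq_card_setU.
have [W'x'|W'x'] := leqP #|W :&: part f' x| (14 * t).
  apply: (IHs f' _ qf' fH' sH' wH') => a.
  by have [->//|/W't] := eqVneq a x.
have big : t <= #|part f' x|.
  by apply: leq_trans (subset_leq_card (subsetIr W _)); lia.
case: (exists_separation qf' dH' fH' big) => X [D [c [X7 AD c4 Dc [DX cl]]]].
exists X, D; split=> //.
  have : #|W :&: part f' x| <= #|W :&: D| + #|X|.
    apply: leq_trans (leq_card_setU _ _); apply/subset_leq_card/subsetP => u.
    rewrite in_setI => /andP[uW /(subsetP AD)]; rewrite !in_setU in_setI uW.
    by [].
  lia.
have : #|W :&: D| <= size (x :: c) * (14 * t + 14 * t).
  apply: (card_in_parts (f := f')).
    by move=> u; rewrite in_setI inE => /andP[_ /Dc].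
  move=> a; apply: (@leq_trans #|W :&: part f' a|).
    by apply/subset_leq_card/setSI/subsetIl.
  by have [->//|/W't/leq_trans->//] := eqVneq a x; rewrite leq_addr.
by move/leq_trans; apply; rewrite /=; nia.
Qed.

End Separation.

(** * Bounded boundaries and merging of components *)

Section Boundary.
Variables (T : finType) (e : rel T).
Hypothesis e_sym : symmetric e.
Implicit Types (Q R X D : {set T}).

(** Only the start of a step has to be outside [Q], so a walk stops as soon as it enters [Q]. A
    single reachability relation thus yields a component together with its neighbours in [Q]. *)
Definition leave Q : rel T := fun a b => (a \notin Q) && e a b.

(* When [u] is not in [Q], this is the set of neighbours in [Q] of the component
   of [u] in the graph without [Q]. *)
Definition boundary Q u : {set T} := [set b in Q | connect (leave Q) u b].

Definition bounded k Q := [forall u, (u \notin Q) ==> (#|boundary Q u| <= k)].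

Lemma leaveS Q R : Q \subset R -> subrel (leave R) (leave Q).
Proof.
move=> /subsetP sQR a b /andP[aR eab]; rewrite /leave eab andbT.
by apply: contraNN aR => /sQR.
Qed.

Lemma connect_leaveS Q R u v :
  Q \subset R -> connect (leave R) u v -> connect (leave Q) u v.
Proof.
move=> sQR; apply: connect_sub => a b /(leaveS sQR); exact: connect1.
Qed.

Lemma connect_leave_rev Q u v :
  connect (leave Q) u v -> v \notin Q -> connect (leave Q) v u.
Proof.
move=> /connectP[p up ->{v}] lQ.
suff [] : u \notin Q /\ connect (leave Q) (last u p) u by [].
elim: p u up lQ => [|v p IHp] u //= /andP[/andP[uQ euv] vp] lQ.
have [vQ cv] := IHp v vp lQ; split=> //; apply: connect_trans cv (connect1 _).
by rewrite /leave vQ e_sym.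
Qed.

Lemma boundary_between Q R u : Q \subset R ->
  boundary R u \subset boundary Q u :|: (R :\: Q).
Proof.
move=> sQR; apply/subsetP => b; rewrite !inE => /andP[-> cb].
by rewrite (connect_leaveS sQR cb) andbT; case: (b \in Q).
Qed.

Lemma bounded_between k m Q R : bounded k Q -> Q \subset R ->
  #|R :\: Q| <= m -> bounded (k + m) R.
Proof.
move=> /forall_inP bQ sQR RQ; apply/forall_inP => u uR.
apply: leq_trans (subset_leq_card (boundary_between u sQR)) _.
apply: leq_trans (leq_card_setU _ _) (leq_add (bQ u _) RQ).
by apply: contraNN uR => /(subsetP sQR).
Qed.

(** If no boundary is full, any vertex can be added. Otherwise a full boundary [W] is split by [X]
    and [D]. A component inside [D] keeps at most [140 * t] of [W] and gains at most [7 * t]; one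
    outside [D] loses more than [7 * t] and gains at most [7 * t]. Both end strictly below
    [154 * t]. *)
Lemma bounded_extend t Q : 0 < t ->
  (forall W : {set T}, 14 * t < #|W| -> exists X D : {set T},
     [/\ separation e X D, #|X| <= 7 * t,
         7 * t < #|W :&: D| & #|W :&: D| <= 140 * t]) ->
  bounded (154 * t) Q -> Q != setT ->
  exists R, [/\ bounded (154 * t) R, Q \proper R & #|R :\: Q| <= 7 * t].
Proof.
move=> t0 sepW bQ nQT.
have [/forall_inP small|] :=
  boolP [forall u in ~: Q, #|boundary Q u| < 154 * t].
  have [v vQ] : exists v, v \notin Q.
    have /subsetPn[v _ vQ] : ~~ (setT \subset Q) by rewrite subTset.
    by exists v.
  have sQR : Q \subset v |: Q by rewrite subsetUr.
  exists (v |: Q); split.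
  - apply/forall_inP => u uR.
    apply: leq_trans (subset_leq_card (boundary_between u sQR)) _.
    apply: leq_trans (leq_card_setU _ _) _.
    rewrite setDUl setDv setU0.
    have : #|[set v] :\: Q| <= 1.
      by rewrite -(cards1 v) subset_leq_card // subsetDl.
    have /small : u \in ~: Q.
      by rewrite inE; apply: contraNN uR => uQ; rewrite inE uQ orbT.
    lia.
  - by rewrite properE sQR; apply/subsetPn; exists v; rewrite ?setU11.
  rewrite setDUl setDv setU0; apply: (@leq_trans 1); last by lia.
  by rewrite -(cards1 v) subset_leq_card // subsetDl.
rewrite negb_forall_in => /exists_inP[u0]; rewrite inE -leqNgt => u0Q bigW.
set W := boundary Q u0 in bigW.
have WM : #|W| <= 154 * t by move/forall_inP: bQ; apply.
have [|X [D [[DX cl] X7 WD7 WD140]]] := sepW W; first lia.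
(* Only the vertices of [X] in the component of [u0] are added, so that no other component gets a
   larger boundary. *)
set C := [set w | (w \notin Q) && connect (leave Q) u0 w].
set R := Q :|: (X :&: C).
have sQR : Q \subset R by rewrite subsetUl.
have notX w : connect (leave Q) u0 w -> w \notin R -> w \notin X.
  by move=> cw; rewrite !inE cw andbT; case: (w \in Q); case: (w \in X).
have stay w p : connect (leave Q) u0 w -> path (leave R) w p ->
    (w \in D :|: X -> last w p \in D :|: X) /\ (w \notin D -> last w p \notin
      D).
  elim: p w => [|v p IHp] w //= cw /andP[/andP[wR ewv] vp].
  have wX := notX w cw wR.
  have wQ : w \notin Q by apply: contraNN wR; apply: (subsetP sQR).
  have [|IH1 IH2] := IHp v _ vp.
    by apply: connect_trans cw (connect1 _); rewrite /leave wQ.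
  split=> wD; last first.
    apply: IH2; apply: contraNN wD => vD.
    by have := cl v w vD; rewrite e_sym inE (negPf wX) orbF => ->.
  apply: IH1; apply: cl ewv.
  by move: wD; rewrite inE (negPf wX) orbF.
have inC w : w \in C -> w \notin R -> #|boundary R w| < 154 * t.
  rewrite inE => /andP[wQ cw] wR.
  have bW b : b \in boundary R w -> b \in X \/ b \in W.
    rewrite !inE => /andP[/orP[bQ'|/and3P[-> _ _]] cb]; last by left.
    by right; rewrite bQ' (connect_trans cw) // (connect_leaveS sQR).
  have [wD|wD] := boolP (w \in D).
    apply: (@leq_ltn_trans #|X :|: (W :&: D)|).
      apply/subset_leq_card/subsetP => b bB; rewrite in_setU in_setI.
      have [->//|->] := bW b bB.
      move: bB; rewrite inE => /andP[_ /connectP[p wp ->]].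
      have [+ _] := stay w p cw wp; rewrite in_setU wD orTb => /(_ isT).
      by rewrite in_setU /= orbC.
    by apply: leq_ltn_trans (leq_card_setU _ _) _; lia.
  apply: (@leq_ltn_trans #|X :|: (W :\: D)|).
    apply/subset_leq_card/subsetP => b bB; rewrite in_setU in_setD.
    have [->//|->] := bW b bB.
    move: bB; rewrite inE => /andP[_ /connectP[p wp ->]].
    by have [_ ->//] := stay w p cw wp; rewrite orbT.
  apply: leq_ltn_trans (leq_card_setU _ _) _.
  have := cardsID D W; lia.
have RQ : R :\: Q \subset X.
  by rewrite setDUl setDv set0U; apply: subset_trans (subsetDl _ _) (subsetIl _
    _).
exists R; split.
- apply/forall_inP => w wR; have [/inC/(_ wR)/ltnW//|wC] := boolP (w \in C).
  have wQ : w \notin Q by apply: contraNN wR; apply: (subsetP sQR).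
  move/forall_inP: bQ => /(_ w wQ); apply: leq_trans.
  apply/subset_leq_card/subsetP => b; rewrite inE => /andP[bR cb].
  have {}cb := connect_leaveS sQR cb; rewrite inE cb andbT.
  move: bR; rewrite /R in_setU in_setI => /orP[//|/andP[_]].
  rewrite inE => /andP[bQ' u0b]; case/negP: wC; rewrite inE wQ.
  exact: connect_trans u0b (connect_leave_rev cb bQ').
(* Strictness gives progress: with [R = Q], the full boundary of [u0] would be below [154 * t]. *)
- rewrite properEneq sQR andbT; apply: contraTneq bigW => QR.
  rewrite -ltnNge /W QR; apply: inC; rewrite -?QR //.
  by rewrite inE u0Q connect0.
exact: leq_trans (subset_leq_card RQ) X7.
Qed.

End Boundary.

(** * Pieces: merging them, reducing them, and the red degree *)

Section Pieces.
Variables (T : finType) (e : rel T).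
Hypothesis e_sym : symmetric e.
Implicit Types (Q : {set T}) (cmp : T -> nat) (H : trigraph T).

(* [cmp] labels the vertices by the pieces that they belong to; a vertex of [H]
   represents the vertices contracted into it. *)
Definition tame cmp H := forall x y, x \in tvert H -> y \in tvert H ->
  cmp x != cmp y -> tadj H x y = e x y /\ ~~ tred H x y.

Definition block cmp H x := [set y in tvert H | cmp y == cmp x].

Lemma tame_red_deg cmp H c : tame cmp H ->
  (forall x, #|block cmp H x| <= c.+1) -> max_red_deg H <= c.
Proof.
move=> tH bH; apply/bigmax_leqP => x xH.
rewrite -ltnS; apply: leq_trans (bH x).
rewrite [in X in _ <= X](cardsD1 x) inE xH eqxx add1n ltnS.
apply/subset_leq_card/subsetP => y; rewrite !inE => rxy.
have yH : y \in tvert H by apply: (@tred_vert _ _ _ x); rewrite tred_sym.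
rewrite yH /=; apply/andP; split.
  by apply: contraTneq rxy => ->; rewrite tred_irr.
apply: contraTT rxy => cyx.
by have [] := tH x y xH yH; rewrite // eq_sym.
Qed.

(** The neighbourhoods of [x] and [y] can only differ inside their piece, so no new red edge leaves
    it. *)
Lemma tame_contract cmp H x y : tame cmp H -> x != y ->
  x \in tvert H -> y \in tvert H -> cmp x = cmp y ->
  (forall w, cmp w != cmp x -> e x w = e y w) -> tame cmp (contract H x y).
Proof.
move=> tH nxy xH yH cxy sxy u v.
rewrite !in_contract_vert // => /andP[uy uH] /andP[vy vH] cuv.
have main w : w \in tvert H -> cmp w != cmp x ->
    tadj (contract H x y) x w = e x w /\ ~~ tred (contract H x y) x w.
  move=> wH cwx; rewrite contract_adj_new contract_red_new.
  have [wx|wx] := eqVneq w x; first by move: cwx; rewrite wx eqxx.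
  have [wy|wy] := eqVneq w y; first by move: cwx; rewrite wy cxy eqxx.
  have [] := tH x w xH wH; rewrite 1?eq_sym // => -> /negPf->.
  have [] := tH y w yH wH; rewrite -?cxy 1?eq_sym // => -> /negPf->.
  by rewrite -sxy // eqxx orbb.
have [ux|ux] := eqVneq u x.
  by rewrite ux; apply: main => //; rewrite -ux eq_sym.
have [vx|vx] := eqVneq v x.
  rewrite vx tadj_sym tred_sym e_sym; apply: main => //; by rewrite -vx.
rewrite contract_adj_old // contract_red_old // uy vy; exact: tH.
Qed.

(* [Q] is the set of the vertices that are still to be processed, and [Q'] is
   [Q :\ v] while [v] is being processed. At the last vertex, all the pieces are
   merged, even if the graph is not connected, whence the case [Q' = set0]. *)
Record partial_merge Q Q' cmp : Prop := PartialMerge {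
  merge_adj : forall u w, u \notin Q -> w \notin Q -> e u w -> cmp u = cmp w;
  merge_join : forall u w, cmp u = cmp w -> u != w ->
    [/\ u \notin Q', w \notin Q' & Q' = set0 \/ connect (leave e Q') u w]
}.

Lemma partial_merge_start Q cmp v : partial_merge Q Q cmp -> v \in Q ->
  partial_merge Q (Q :\ v) cmp.
Proof.
case=> ma mj vQ; split=> // u w cuw nuw.
have [uQ wQ [Q0|cQ]] := mj u w cuw nuw; first by rewrite Q0 inE in vQ.
rewrite !inE !negb_and uQ wQ !orbT; split=> //; right.
by apply: connect_leaveS cQ; apply: subsetDl.
Qed.

Lemma partial_merge_end Q cmp v : partial_merge Q (Q :\ v) cmp ->
  (forall u, u \notin Q -> e v u -> cmp u = cmp v) ->
  partial_merge (Q :\ v) (Q :\ v) cmp.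
Proof.
case=> ma mj av; split=> // u w; rewrite !inE !negb_and !negbK.
case/orP=> [/eqP->|uQ]; case/orP=> [/eqP->|wQ] // euw.
- by rewrite av.
- by rewrite av // e_sym.
exact: ma.
Qed.

Definition relabel cmp a b u := if cmp u == a then b else cmp u.

(** Once [v] has left [Q] it no longer stops walks, so the two pieces are linked outside [Q :\ v] by
    the edge from [v] to [u]. *)
Lemma partial_merge_relabel Q v u cmp : v \in Q ->
  partial_merge Q (Q :\ v) cmp ->
  Q :\ v = set0 \/ u \notin Q /\ e v u ->
  partial_merge Q (Q :\ v) (relabel cmp (cmp u) (cmp v)).
Proof.
move=> vQ [ma mj] uv; split.
  by move=> x y xQ yQ exy; rewrite /relabel (ma x y).
have [Q0|nQ0] := eqVneq (Q :\ v) set0.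
  by rewrite Q0 => x y _ _; rewrite !inE; split=> //; left.
have [uQ evu] : u \notin Q /\ e v u.
  by case: uv => // Q0; rewrite Q0 eqxx in nQ0.
have vQ' : v \notin Q :\ v by rewrite !inE eqxx.
have uQ' : u \notin Q :\ v by rewrite !inE negb_and uQ orbT.
have cvu : connect (leave e (Q :\ v)) v u.
  by apply: connect1; rewrite /leave vQ'.
have cuv := connect_leave_rev e_sym cvu uQ'.
have mj' x y : cmp x = cmp y -> y \notin Q :\ v ->
    x \notin Q :\ v /\ connect (leave e (Q :\ v)) x y.
  have [->|nxy] := eqVneq x y => cxy yQ; first by rewrite connect0.
  by have [xQ _ [Q0|]] := mj x y cxy nxy; first by rewrite Q0 eqxx in nQ0.
move=> x y + nxy; rewrite /relabel.
have main x' y' : cmp x' = cmp u -> cmp v = cmp y' ->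
  [/\ x' \notin Q :\ v, y' \notin Q :\ v,
      connect (leave e (Q :\ v)) x' y' & connect (leave e (Q :\ v)) y' x'].
  move=> xu yv; have [xQ cxu] := mj' x' u xu uQ'.
  have [yQ cyv] := mj' y' v (esym yv) vQ'.
  have cyx : connect (leave e (Q :\ v)) y' x'.
    apply: connect_trans cyv (connect_trans cvu _).
    exact: connect_leave_rev cxu uQ'.
  by split=> //; apply: connect_leave_rev cyx xQ.
case: eqP => [xu|_]; case: eqP => [yu|_] cxy.
- by apply: mj => //; rewrite xu yu.
- by have [xQ yQ c _] := main x y xu cxy; split=> //; right.
- by have [yQ xQ _ c] := main y x yu (esym cxy); split=> //; right.
exact: mj.
Qed.

Lemma tame_relabel cmp H a b : tame cmp H -> tame (relabel cmp a b) H.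
Proof.
move=> tH x y xH yH cxy; apply: tH => //.
by apply: contraNneq cxy => cxy; rewrite /relabel cxy.
Qed.

Lemma block_relabel cmp H u v x b : cmp u != cmp v ->
  (forall y, #|block cmp H y| <= b) ->
  #|block (relabel cmp (cmp u) (cmp v)) H x|
    <= if relabel cmp (cmp u) (cmp v) x == cmp v then b + b else b.
Proof.
move=> nuv bb; case: ifP => [/eqP xv|xv].
  apply: leq_trans (leq_add (bb u) (bb v)).
  apply: leq_trans (leq_card_setU _ _); apply/subset_leq_card/subsetP => y.
  rewrite !inE xv => /andP[-> /=]; rewrite /relabel.
  by case: (cmp y == cmp u).
apply: leq_trans (bb x); apply/subset_leq_card/subsetP => y.
rewrite !inE => /andP[-> /=]; move: xv; rewrite /relabel.
case: (eqVneq (cmp x) (cmp u)) => [_|xu]; first by rewrite eqxx.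
by case: (cmp y == cmp u) => //; rewrite eq_sym => ->.
Qed.

(** Two vertices of the piece other than [v] are told apart by a vertex outside the piece. It lies
    in [Q :\ v], since neighbours outside [Q] have the same label, and hence in the boundary; so the
    traces on at most [k] vertices are distinct. The vertex [v] is counted apart, because some of
    its processed neighbours may not have been merged with it yet. *)
Lemma card_reduced Q v cmp H k :
  bounded e k (Q :\ v) -> v \in Q -> partial_merge Q (Q :\ v) cmp ->
  (forall x y, x \in tvert H -> y \in tvert H -> x != y -> cmp x = cmp v ->
     cmp y = cmp v -> exists2 w, cmp w != cmp v & e x w != e y w) ->
  #|block cmp H v| <= (2 ^ k).+1.
Proof.
move=> /forall_inP bQ vQ [ma mj] red.
set S := boundary e (Q :\ v) v; set A := block cmp H v :\ v.
have SK : #|S| <= k by apply: bQ; rewrite !inE eqxx.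
have AP x : x \in A -> [/\ x \in tvert H, cmp x = cmp v, x != v & x \notin Q].
  rewrite !inE => /and3P[xv xH /eqP cxv]; split=> //.
  by have [] := mj x v cxv xv; rewrite !inE negb_and xv.
have ntr x y : x \in A -> y \in A -> x != y ->
    exists2 w, w \in S & e x w != e y w.
  move=> /AP[xH cxv xv xQ] /AP[yH cyv yv yQ] nxy.
  have [w wv exy] := red x y xH yH nxy cxv cyv; exists w => //.
  wlog exw : x y xH cxv xv xQ yH cyv yv yQ nxy exy / e x w.
    move=> wl; have [exw|nxw] := boolP (e x w); first exact: (wl x y).
    apply: (wl y x) => //; rewrite 1?eq_sym //.
    by move: exy; rewrite (negPf nxw); case: (e y w).
  have wQ : w \in Q.
    by apply: contraNT wv => wQ; rewrite -cxv (ma x w).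
  have wnv : w != v by apply: contraNneq wv => ->.
  have nvx : v != x by rewrite eq_sym.
  have [_ _ [Q0|cxw]] := mj v x (esym cxv) nvx.
    have : w \in Q :\ v by rewrite !inE wnv.
    by rewrite Q0 inE.
  rewrite !inE wnv wQ; apply: connect_trans cxw (connect1 _).
  by rewrite /leave exw !inE negb_and xQ orbT.
apply: (@leq_trans #|A|.+1).
  by rewrite (cardsD1 v) -add1n leq_add2r leq_b1.
rewrite ltnS; apply: (@leq_trans #|powerset S|); last first.
  by rewrite card_powerset leq_exp2l.
pose tr x := [set w in S | e x w].
rewrite -(card_in_imset (f := tr)).
  apply/subset_leq_card/subsetP => _ /imsetP[x _ ->].
  by rewrite powersetE; apply/subsetP => w; rewrite inE => /andP[].
move=> x y xA yA /setP trxy; apply/eqP/negPn/negP => nxy.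
have [w wS /negP] := ntr x y xA yA nxy; apply.
by have := trxy w; rewrite [w \in tr x]inE [w \in tr y]inE wS /= => ->.
Qed.

(** Built from the right, since the program appends pairs, whereas [contraction_seq] recurses from
    the left. The bound is recorded for the trigraphs before each contraction, not for the last
    one. *)
Inductive reached c H0 : seq (T * T) -> trigraph T -> Prop :=
  | ReachedNil : reached c H0 [::] H0
  | ReachedRcons s H x y of reached c H0 s H & x != y &
      x \in tvert H & y \in tvert H & max_red_deg H <= c :
      reached c H0 (rcons s (x, y)) (contract H x y).

Lemma reached_contraction_seq c H0 s H : reached c H0 s H ->
  #|tvert H| = 1 -> max_red_deg H <= c ->
  contraction_seq H0 s /\ width H0 s <= c.
Proof.
move=> rsH H1 Hc.
suff main s2 : contraction_seq H s2 -> width H s2 <= c ->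
    contraction_seq H0 (s ++ s2) /\ width H0 (s ++ s2) <= c.
  by rewrite -(cats0 s); apply: main => /=; rewrite ?H1 // maxn0.
elim: {H1 Hc}rsH s2 => // s' H' x y _ IH nxy xH yH H'c s2 sH wH.
by rewrite -cats1 -catA; apply: IH; rewrite /= ?nxy ?xH ?yH // geq_max H'c.
Qed.

End Pieces.

(** * Loop programs *)

(* A [LFor x p] runs [p] with cell 0 of array [x] ranging from 0 to [n - 1],
   where [n] is the content of cell 0 of array 0, i.e. the number of vertices of
   the input: such programs always halt in polynomial time. *)
Inductive lprog :=
  | LSkip
  | LPut (a : nat) (i e : expr)
  | LSeq (p q : lprog)
  | LIf (e : expr) (p q : lprog)
  | LFor (x : nat) (p : lprog).

Definition V x := Get x (Cst 0).

Fixpoint compile p : prog :=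
  match p with
  | LSkip => Skip
  | LPut a i e => Put a i e
  | LSeq p q => Seq (compile p) (compile q)
  | LIf e p q => If e (compile p) (compile q)
  | LFor x p =>
      Seq (Put x (Cst 0) (Cst 0))
        (While (Defs.Sub (V 0) (V x))
           (Seq (compile p) (Put x (Cst 0) (Add (V x) (Cst 1)))))
  end.

Fixpoint den p (st : store) : store :=
  match p with
  | LSkip => st
  | LPut a i e => update st a (eval st i) (eval st e)
  | LSeq p q => den q (den p st)
  | LIf e p q => if eval st e != 0 then den p st else den q st
  | LFor x p =>
      iter (st 0 0) (fun s => update (den p s) x 0 (den p s x 0 + 1))
        (update st x 0 0)
  end.

Fixpoint writes a p : bool :=
  match p with
  | LSkip => false
  | LPut b _ _ => b == a
  | LSeq p q | LIf _ p q => writes a p || writes a q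
  | LFor x p => (x == a) || writes a p
  end.

Fixpoint well_formed p : bool :=
  match p with
  | LSkip | LPut _ _ _ => true
  | LSeq p q | LIf _ p q => well_formed p && well_formed q
  | LFor x p => ~~ writes x p && well_formed p
  end.

(** A loop costs two extra steps per round, for its test and its increment, and two more for the
    initialisation and the failing test. A conditional is charged for both branches. *)
Fixpoint cost p : {poly nat} :=
  match p with
  | LSkip => 0
  | LPut _ _ _ => 1
  | LSeq p q => cost p + cost q
  | LIf _ p q => cost p + cost q + 1
  | LFor x p => 'X * (cost p + polyC 2%N) + polyC 2%N
  end%R.

Lemma den_frame a p st i : ~~ writes a p -> den p st a i = st a i.
Proof.
elim: p st => //= [b j e|p IHp q IHq|e p IHp q IHq|x p IHp] st.
- by rewrite /update eq_sym => /negPf->.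
- by case/norP=> ap aq; rewrite IHq // IHp.
- by case/norP=> ap aq; case: ifP => _; rewrite ?IHp ?IHq.
case/norP=> xa ap; elim: (st 0 0) => [|n IHn] /=.
  by rewrite /update eq_sym (negPf xa).
by rewrite {1}/update eq_sym (negPf xa) /= IHp.
Qed.

Lemma exec_compile p st : well_formed p -> ~~ writes 0 p ->
  exists2 k, exec (compile p) st k (den p st) & k <= (cost p).[st 0 0]%R.
Proof.
elim: p st => /= [|a i e|p IHp q IHq|e p IHp q IHq|x p IHp] st.
- by exists 0; [constructor|].
- by exists 1; [constructor|rewrite hornerC].
- case/andP=> wp wq /norP[p0 q0].
  have [k kp kc] := IHp st wp p0; have [l lq lc] := IHq (den p st) wq q0.
  exists (k + l); first by econstructor; eauto.
  by rewrite hornerD leq_add // -(den_frame st 0 p0).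
- case/andP=> wp wq /norP[p0 q0]; case: ifPn => [ep|].
    have [k kp kc] := IHp st wp p0; exists k.+1; first exact: ExecIfTrue.
    rewrite !hornerD hornerC -[_.+1]addn1 leq_add2r.
    exact: leq_trans kc (leq_addr _ _).
  rewrite negbK => /eqP ep; have [k kq kc] := IHq st wq q0.
  exists k.+1; first exact: ExecIfFalse.
  rewrite !hornerD hornerC -[_.+1]addn1 leq_add2r.
  exact: leq_trans kc (leq_addl _ _).
case/andP=> xp wp /norP[x0 p0].
set n := st 0 0; set body := fun s : store => _.
set loop := While _ _; set c := (cost p).[n]%R.
have body0 m s : iter m body s 0 0 = s 0 0.
  by elim: m => //= m <-; rewrite /body /update eq_sym (negPf x0) /= den_frame.
have run m s : s 0 0 = n -> s x 0 + m = n ->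
    exists2 k, exec loop s k (iter m body s) & k <= m * (c + 2) + 1.
  elim: m s => [|m IHm] s s0 sm.
    exists 1; last by rewrite mul0n.
    by constructor; rewrite /= s0 -sm addn0 subnn.
  have [k kp kc] := IHp s wp p0.
  have [||l ll lc] := IHm (body s).
  - by rewrite -[body s]/(iter 1 body s) body0.
  - by rewrite /body /update /= !eqxx /= den_frame // addn1 addSnnS.
  rewrite iterSr; exists (k + 1 + l).+1.
    apply: ExecWhileTrue ll; first by rewrite /= s0 -sm; lia.
    by econstructor; [exact: kp|exact: ExecPut].
  by move: kc; rewrite s0 -/c; nia.
have [||k kl kc] := run n (update st x 0 0).
- by rewrite /update eq_sym (negPf x0).
- by rewrite /update !eqxx.
exists (1 + k); first by econstructor; [exact: ExecPut|exact: kl].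
have -> : ('X * (cost p + polyC 2%N) + polyC 2%N)%R.[n]%R = n * (c + 2) + 2.
  by rewrite hornerD hornerM hornerX hornerD !hornerC.
by rewrite add1n addn2 -addn1 -addn1 in kc *; lia.
Qed.

Lemma den_for n (I : nat -> store -> Prop) (x : nat) p st :
  st 0 0 = n -> x != 0 -> ~~ writes 0 p -> ~~ writes x p ->
  (forall j s v, I j s -> I j (update s x 0 v)) -> I 0 st ->
  (forall (j : 'I_n) (s : store), s x 0 = j ->
     (forall a i, ~~ writes a (LFor x p) -> s a i = st a i) ->
     I j s -> I j.+1 (den p s)) ->
  I n (den (LFor x p) st).
Proof.
move=> st0 x0 p0 px Ix I0 step /=; rewrite st0.
set body := fun s : store => _.
suff main j : j <= n -> [/\ I j (iter j body (update st x 0 0)),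
    iter j body (update st x 0 0) x 0 = j
  & forall a i, ~~ writes a (LFor x p) ->
      iter j body (update st x 0 0) a i = st a i].
  by have [] := main n (leqnn n).
elim: j => [_|j IHj ltjn] /=.
  split; rewrite ?{1}/update ?eqxx //; first exact: Ix.
  by move=> a i /norP[xa _]; rewrite /update eq_sym (negPf xa).
have [Ij jx jf] := IHj (ltnW ltjn).
set s := iter j _ _ in Ij jx jf *.
split.
- exact/Ix/(step (Ordinal ltjn)).
- by rewrite /body /update !eqxx /= den_frame // jx addn1.
move=> a i /norP[xa pa].
by rewrite /body /update eq_sym (negPf xa) /= den_frame // jf //= negb_or xa.
Qed.

(** Truncated subtraction yields Boolean tests with values 0 and 1: conjunction by De Morgan,
    equality by the vanishing of both differences. *)
Definition eNot e := Defs.Sub (Cst 1) e.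
Definition eAnd e1 e2 := eNot (Add (eNot e1) (eNot e2)).
Definition eEq e1 e2 := eNot (Add (Defs.Sub e1 e2) (Defs.Sub e2 e1)).

Lemma eval_not st e : eval st (eNot e) = (eval st e == 0).
Proof. by rewrite /=; case: (eval st e). Qed.

Lemma eval_and st e1 e2 :
  eval st (eAnd e1 e2) = (eval st e1 != 0) && (eval st e2 != 0).
Proof. by rewrite /=; case: (eval st e1); case: (eval st e2). Qed.

Lemma eval_eq st e1 e2 : eval st (eEq e1 e2) = (eval st e1 == eval st e2).
Proof. by rewrite /=; lia. Qed.

Definition cell a x := Get a (V x).

Lemma eval_add st e1 e2 : eval st (Add e1 e2) = eval st e1 + eval st e2.
Proof. by []. Qed.

Lemma eval_sub st e1 e2 : eval st (Defs.Sub e1 e2) = eval st e1 - eval st e2.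
Proof. by []. Qed.

Lemma eval_cst st c : eval st (Cst c) = c.
Proof. by []. Qed.

Lemma eval_V st x : eval st (V x) = st x 0.
Proof. by []. Qed.

Lemma eval_cell st a x : eval st (cell a x) = st a (st x 0).
Proof. by []. Qed.

Definition evalE :=
  (eval_not, eval_and, eval_eq, eval_add, eval_sub, eval_cst, eval_V,
    eval_cell).

Arguments eNot : simpl never.
Arguments eAnd : simpl never.
Arguments eEq : simpl never.

Definition setv x e := LPut x (Cst 0) e.
Definition seqs := foldr LSeq LSkip.

Lemma den_put a i e st : den (LPut a i e) st = update st a (eval st i) (eval st
  e).
Proof. by []. Qed.

Lemma den_set x e st : den (setv x e) st = update st x 0 (eval st e).
Proof. by []. Qed.

Lemma den_seq p q st : den (LSeq p q) st = den q (den p st).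
Proof. by []. Qed.

Lemma den_seqs p ps st : den (seqs (p :: ps)) st = den (seqs ps) (den p st).
Proof. by []. Qed.

Lemma den_seqs0 st : den (seqs [::]) st = st.
Proof. by []. Qed.

Lemma den_if e p q st :
  den (LIf e p q) st = if eval st e != 0 then den p st else den q st.
Proof. by []. Qed.

Lemma den_skip st : den LSkip st = st.
Proof. by []. Qed.

Definition denE :=
  (den_put, den_set, den_seq, den_seqs, den_seqs0, den_if, den_skip).

Arguments den : simpl never.

(** * The search for an ordering *)

(* Arrays: 5 row offsets of the adjacency matrix; 10 the current set, 11 the
   candidate set, 12 the chosen set; 13 the reached vertices; 14 the order;
   15 the labels of the pieces; 16 the vertices that have disappeared; 17 the
   vertices that have been processed. The others hold a single number. *)
Definition eAdj x y := Get 1 (Add (cell 5 x) (V y)).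

(** Without multiplication, the offsets [i * n] are accumulated by repeated addition. *)
Definition rows :=
  LFor 20 (LSeq (LPut 5 (V 20) (V 21)) (setv 21 (Add (V 21) (V 0)))).

(** Rounds in the manner of Bellman and Ford: counter 24 repeats [n] times a pass over all pairs.
    Entries of array 13 may exceed 1; only being nonzero matters. *)
Definition reach :=
  seqs [:: LFor 23 (LPut 13 (V 23) (Cst 0));
           LPut 13 (V 22) (Cst 1);
           LFor 24 (LFor 25 (LFor 26 (LPut 13 (V 26) (Add (cell 13 26)
             (eAnd (eAnd (cell 13 25) (eNot (cell 11 25))) (eAdj 25 26))))))].

Definition check k :=
  LSeq (setv 27 (Cst 1)) (LFor 22 (LIf (cell 11 22) LSkip
    (seqs [:: reach;
              setv 28 (Cst 0);
              LFor 23 (setv 28 (Add (V 28) (eAnd (cell 13 23) (cell 11 23))));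
              LIf (Defs.Sub (V 28) (Cst k)) (setv 27 (Cst 0)) LSkip]))).

(** As the candidate is to contain the current set, a nonzero count in 29 means strict growth. Cell
    30 is never reset here, so a success persists through the search. *)
Definition test k :=
  seqs [:: check k;
           setv 29 (Cst 0);
           LFor 23 (setv 29 (Add (V 29) (eAnd (cell 11 23) (eNot (cell 10
             23)))));
           LIf (eAnd (V 27) (V 29))
             (LSeq (setv 30 (Cst 1)) (LFor 23 (LPut 12 (V 23) (cell 11 23))))
             LSkip].

(* If some set [R] containing the candidate, with at most [m] more elements, passes
   [test k], then such a set is stored in array 12. *)
Fixpoint search k m :=
  if m is m'.+1 then
    LSeq (search k m')
      (LFor (100 + m) (LIf (cell 11 (100 + m)) LSkip
        (seqs [:: LPut 11 (V (100 + m)) (Cst 1);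
                  search k m';
                  LPut 11 (V (100 + m)) (Cst 0)])))
  else test k.

Section Specs.
Variable G : sgraph.
Notation n := (nvert G).
Notation T := 'I_(nvert G).
Notation e := (@adj G).

Definition marked (st : store) a : {set T} := [set i : T | st a i != 0].

Definition ready st := [/\ st 0 0 = n, forall i : T, st 5 i = i * n
  & forall k, st 1 k = input G 1 k].

Lemma input_adj (i j : T) : input G 1 (i * n + j) = e i j.
Proof.
rewrite /input; congr nat_of_bool; apply/existsP/idP => [[i' /existsP[j']]|eij].
  case/andP=> /eqP ij eij.
  have ii : i = i' :> nat.
    have := congr1 (divn^~ n) ij.
    by rewrite !divnMDl ?nvert_gt0 // !divn_small // !addn0.
  have jj : j = j' :> nat by move: ij; rewrite ii => /addnI.
  by rewrite (val_inj ii) (val_inj jj).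
by exists i; apply/existsP; exists j; rewrite eqxx.
Qed.

Lemma eval_adj st x y (i j : T) : ready st -> st x 0 = i -> st y 0 = j ->
  eval st (eAdj x y) = e i j.
Proof. by case=> _ r5 r1 /= -> ->; rewrite r1 r5 input_adj. Qed.

Lemma ready_frame st st' : (forall a i, a \in [:: 0; 1; 5] -> st' a i = st a i)
  ->
  ready st -> ready st'.
Proof.
by move=> f [r0 r5 r1]; split=> [|i|k]; rewrite f // ?inE ?eqxx ?orbT.
Qed.

Lemma ready_den p st : ~~ [|| writes 0 p, writes 1 p | writes 5 p] ->
  ready st -> ready (den p st).
Proof.
rewrite !negb_or => /and3P[w0 w1 w5]; apply: ready_frame => a i.
by rewrite !inE => /or3P[] /eqP->; rewrite den_frame.
Qed.

Lemma ready_update st a i v : a \notin [:: 0; 1; 5] -> ready st ->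
  ready (update st a i v).
Proof.
move=> na; apply: ready_frame => b j nb; rewrite /update.
by case: eqP nb => // ->; rewrite (negPf na).
Qed.

Lemma rowsP st : st 0 0 = n -> (forall k, st 1 k = input G 1 k) ->
  st 21 0 = 0 -> ready (den rows st).
Proof.
move=> st0 st1 st21.
split; [by rewrite den_frame| |by move=> k; rewrite den_frame].
suff [_ H] : den rows st 21 0 = n * n /\
    forall i : T, i < n -> den rows st 5 i = i * n by move=> i; apply: H.
pose I j (s : store) := s 21 0 = j * n /\
  forall i : T, i < j -> s 5 i = i * n.
apply: (@den_for n I) => // j s s20 fs [s21 s5].
rewrite /I !denE /= s20; split; first by rewrite /update /= s21 (fs 0) // st0
  mulSn addnC.
move=> i; rewrite ltnS leq_eqVlt => /orP[/eqP ij|ij].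
  by rewrite /update /= ij eqxx.
by rewrite /update /= (ltn_eqF ij) s5.
Qed.

(** Marks are always sound; after [j] rounds they cover the walks with at most [j] steps, and a walk
    without repetition has fewer than [n] steps. *)
Lemma reachP st (u : T) : ready st -> st 22 0 = u ->
  forall b : T, (den reach st 13 b != 0)
    = connect (leave e (marked st 11)) u b.
Proof.
move=> rst st22; set Q := marked st 11.
rewrite /reach !denE /=; set s1 := den (LFor 23 _) st.
set s2 := update s1 _ _ _.
have s1E (b : T) : s1 13 b = 0.
  pose I j (s : store) := forall b : T, b < j -> s 13 b = 0.
  apply: (_ : I n s1) (ltn_ord b).
  apply: den_for => //; first by case: rst.
  move=> j s s23 _ Is i; rewrite !denE /update /= s23 ltnS leq_eqVlt.
  by case: eqP => //= _; apply: Is.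
have s1f a i : a \notin [:: 13; 23] -> s1 a i = st a i.
  move=> na; rewrite /s1 den_frame //=; move: na; rewrite !inE negb_or.
  by rewrite ![a == _]eq_sym orbC negb_or.
have s2E (b : T) : s2 13 b = (b == u).
  rewrite /s2 /update /= s1f // st22; case: (eqVneq b u) => [->|bu].
    by rewrite eqxx.
  by rewrite (inj_eq val_inj) (negPf bu) s1E.
have s2f a i : a \notin [:: 13; 23] -> s2 a i = st a i.
  move=> na; rewrite /s2 /update (s1f a) //.
  by move: na; rewrite !inE negb_or => /andP[/negPf-> _].
pose sound (s : store) := forall b : T, s 13 b != 0 -> connect (leave e Q) u b.
have rs2 : ready s2.
  by apply: ready_frame rst => a i; rewrite !inE => /or3P[]/eqP->; apply: s2f.
have Qs (s : store) (a : T) : (forall a, s 11 a = s2 11 a) ->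
    (s 11 a != 0) = (a \in Q).
  by move=> ->; rewrite inE s2f.
set p1 := LPut 13 _ _; set p2 := LFor 26 p1; set p3 := LFor 25 p2.
have step1 (a b : T) s : ready s -> (forall a, s 11 a = s2 11 a) ->
    s 25 0 = a -> s 26 0 = b -> sound s ->
    [/\ sound (den p1 s), forall c : T, s 13 c != 0 -> den p1 s 13 c != 0
      & s 13 a != 0 -> leave e Q a b -> den p1 s 13 b != 0].
  move=> rs s11 s25 s26 snd.
  have E (c : T) : (den p1 s 13 c != 0) =
      (s 13 c != 0) || ((c == b) && ((s 13 a != 0) && leave e Q a b)).
    rewrite /p1 denE /update [_ == 13]/= [eval s (V 26)]/= s26.
    rewrite (inj_eq val_inj); case: (eqVneq c b) => [->|_]; last by rewrite
      orbF.
    rewrite !evalE (eval_adj rs s25 s26) s25 s26 addn_eq0 negb_and.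
    rewrite !eqb0 !negbK /leave -(Qs s a s11). by rewrite negbK -andbA.
  split=> [c|c|sa ab]; rewrite E.
  - case/orP=> [/snd//|/and3P[/eqP-> sa ab]].
    exact: connect_trans (snd a sa) (connect1 ab).
  - by move->.
  by rewrite eqxx sa ab orbT.
have step2 (a : T) s : ready s -> (forall a, s 11 a = s2 11 a) ->
    s 25 0 = a -> sound s ->
    [/\ sound (den p2 s), forall c : T, s 13 c != 0 -> den p2 s 13 c != 0
      & forall b : T, s 13 a != 0 -> leave e Q a b -> den p2 s 13 b != 0].
  move=> rs s11 s25 snd.
  pose I j (s' : store) :=
    [/\ sound s', forall c : T, s 13 c != 0 -> s' 13 c != 0
      & forall b : T, b < j -> s 13 a != 0 -> leave e Q a b -> s' 13 b != 0].
  have [] : I n (den p2 s).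
    apply: den_for => //; first by case: rs.
    move=> j s' s'26 fs' [snd' mono prog].
    have [|||snd'' mono' prog'] := step1 a j s' _ _ _ s'26 snd'.
    + by apply: ready_frame rs => c i; rewrite !inE => /or3P[]/eqP->; apply:
      fs'.
    + by move=> c; rewrite fs' // s11.
    + by rewrite fs'.
    split=> // [c /mono/mono'//|b]; rewrite ltnS leq_eqVlt =>
      /orP[/eqP/val_inj->|].
      by move=> sa; apply: prog'; apply: mono.
    by move=> bj sa ab; apply/mono'/prog.
  by move=> ? ? prog; split=> // b; apply: prog.
have step3 s : ready s -> (forall a, s 11 a = s2 11 a) -> sound s ->
    [/\ sound (den p3 s), forall c : T, s 13 c != 0 -> den p3 s 13 c != 0
      & forall a b : T, s 13 a != 0 -> leave e Q a b -> den p3 s 13 b != 0].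
  move=> rs s11 snd.
  pose I j (s' : store) :=
    [/\ sound s', forall c : T, s 13 c != 0 -> s' 13 c != 0
      & forall a b : T, a < j -> s 13 a != 0 -> leave e Q a b -> s' 13 b != 0].
  have [] : I n (den p3 s).
    apply: den_for => //; first by case: rs.
    move=> j s' s'25 fs' [snd' mono prog].
    have [||snd'' mono' prog'] := step2 j s' _ _ s'25 snd'.
    + by apply: ready_frame rs => c i; rewrite !inE => /or3P[]/eqP->; apply:
      fs'.
    + by move=> c; rewrite fs' // s11.
    split=> // [c /mono/mono'//|a b]; rewrite ltnS leq_eqVlt.
    case/orP=> [/eqP/val_inj->|]; first by move=> sa; apply: prog'; apply: mono.
    by move=> bj sa ab; apply/mono'/(prog a).
  by move=> ? ? prog; split=> // a b; apply: prog.
pose I j (s : store) := sound s /\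
  forall p, path (leave e Q) u p -> size p <= j -> s 13 (last u p) != 0.
have [snd cpl] : I n (den (LFor 24 p3) s2).
  apply: den_for => //; first by case: rs2.
  - split; first by move=> b; rewrite s2E eqb0 negbK => /eqP->; exact: connect0.
    by move=> [|//] _ _ /=; rewrite s2E eqxx.
  move=> j s s24 fs [snd cpl].
  have [||snd' mono prog] := step3 s _ _ snd.
  + by apply: ready_frame rs2 => c i; rewrite !inE => /or3P[]/eqP->; apply: fs.
  + by move=> c; rewrite fs.
  split=> // p; case/lastP: p => [_ _|p b]; first exact/mono/(cpl [::]).
  rewrite rcons_path last_rcons size_rcons ltnS => /andP[up lb] pj.
  exact: prog (cpl p up pj) lb.
move=> b; apply/idP/connectP => [/snd/connectP//|[p up ->]].
have [p' up' Up _] := shortenP up; apply: cpl => //.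
have := max_card [pred x in u :: p']; rewrite (card_uniqP Up) card_ord /=.
exact: ltnW.
Qed.

Lemma ltn_ordS (i j : T) : (i < j.+1) = (i == j) || (i < j).
Proof. by rewrite ltnS leq_eqVlt. Qed.

Lemma den_count x c E st (F : T -> bool) :
  st 0 0 = n -> st c 0 = 0 -> [&& x != 0, c != 0 & c != x] ->
  (forall (j : T) (s : store), s x 0 = j ->
     (forall a i, a \notin [:: x; c] -> s a i = st a i) -> eval s E = F j) ->
  den (LFor x (setv c (Add (V c) E))) st c 0 = #|[set j | F j]|.
Proof.
move=> st0 stc /and3P[x0 c0 cx] EF.
pose I j (s : store) := s c 0 = #|[set i : T | (i < j) && F i]|.
suff : I n (den (LFor x (setv c (Add (V c) E))) st).
  by move=> ->; apply: eq_card => i; rewrite !inE ltn_ord.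
apply: den_for => //=.
- by move=> j s v; rewrite /I /update (negPf cx).
- by rewrite /I stc; apply/esym/eqP; rewrite cards_eq0; apply/eqP/setP => i;
    rewrite !inE.
move=> j s sx fs; rewrite /I denE /update !eqxx /= => ->.
rewrite (EF j s sx); last first.
  by move=> a i na; apply: fs; move: na; rewrite !inE /= !negb_or ![a ==
    _]eq_sym.
have [Fj|Fj] := boolP (F j).
  have -> : [set i : T | (i < j.+1) && F i] = j |: [set i : T | (i < j) && F i].
    apply/setP => i; rewrite !inE ltn_ordS.
    by have [->|] := eqVneq i j; rewrite ?Fj.
  by rewrite cardsU1 inE ltnn addnC.
rewrite addn0; apply: eq_card => i; rewrite !inE ltn_ordS.
by have [->|] := eqVneq i j; rewrite ?(negPf Fj) ?andbF.
Qed.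

Lemma checkP k st : ready st ->
  (den (check k) st 27 0 != 0) = bounded e k (marked st 11).
Proof.
move=> rst; set Q := marked st 11; rewrite /check !denE.
pose I j (s : store) := (s 27 0 != 0) =
  [forall u : T, (u < j) && (u \notin Q) ==> (#|boundary e Q u| <= k)].
set st1 := update _ _ _ _; set body := LIf _ _ _.
suff -> : I n (den (LFor 22 body) st1).
  by apply: eq_forallb => u; rewrite ltn_ord.
apply: den_for => //; first by case: rst.
  by rewrite /I; apply/esym/forallP => u; rewrite ltn0.
move=> j s s22 fs Is.
have rs : ready s.
  by apply: ready_frame rst => a i; rewrite !inE => /or3P[]/eqP->; rewrite fs.
have sQ : marked s 11 = Q by apply/setP => i; rewrite !inE fs.
rewrite /I.
have -> : [forall u : T, (u < j.+1) && (u \notin Q) ==> (#|boundary e Q u| <=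
  k)]
    = (s 27 0 != 0) && ((j \notin Q) ==> (#|boundary e Q j| <= k)).
  rewrite Is; apply/forallP/andP => [H|[/forallP H Hj] u].
    split; last by have := H j; rewrite leqnn.
    by apply/forallP => u; apply/implyP => /andP[uj uQ]; have := H u;
      rewrite uQ ltn_ordS uj orbT.
  by have := H u; rewrite ltn_ordS; case: eqP => [->|].
have fj : s 11 j = st 11 j by rewrite fs.
rewrite /body den_if evalE s22 fj inE negbK.
have [sj|_] := eqVneq (st 11 j) 0; last by rewrite den_skip andbT.
rewrite den_seqs; set s1 := den reach s; rewrite !denE.
set s2 := update s1 _ _ _; set s3 := den (LFor 23 _) s2.
have s1E (b : T) : (s1 13 b != 0) = connect (leave e Q) j b.
  by rewrite /s1 (reachP rs s22) sQ.
have s3c : s3 28 0 = #|boundary e Q j|.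
  rewrite /s3 (@den_count 23 28 _ _ (fun b => (b \in Q) && connect (leave e Q) j
    b)).
  - by apply: eq_card => b; rewrite !inE.
  - by rewrite /s2 /update /= /s1 den_frame //; case: rs.
  - by [].
  - by [].
  move=> b s' s'23 fs'; rewrite !evalE s'23 !fs' // /s2 /update /= s1E andbC.
  by rewrite /s1 den_frame // -sQ inE.
have s327 : s3 27 0 = s 27 0.
  by rewrite /s3 den_frame // /s2 /update /= /s1 den_frame.
rewrite !evalE s3c subn_eq0 -ltnNge ltnNge.
by case: leqP => _ /=; rewrite ?s327 ?andbT ?andbF.
Qed.

Lemma marked_frame st st' a : (forall i, st' a i = st a i) ->
  marked st' a = marked st a.
Proof. by move=> f; apply/setP => i; rewrite !inE f. Qed.

Lemma den_copy st x a b : st 0 0 = n -> x != 0 -> b != 0 -> b != x -> a != x ->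
  a != b -> marked (den (LFor x (LPut b (V x) (cell a x))) st) b = marked st a.
Proof.
move=> st0 x0 b0 bx ax ab; set p := LPut _ _ _.
pose I j (s : store) := forall i : T, i < j -> s b i = st a i.
suff Ip : I n (den (LFor x p) st) by apply/setP => i; rewrite !inE Ip.
apply: den_for => //=.
  by move=> j s v Is i ij; rewrite /update (negPf bx) Is.
move=> j s sx fs Is i; rewrite ltn_ordS /p denE !evalE sx /update eqxx /=.
rewrite (inj_eq val_inj); case: eqP => [-> _|_ /Is//].
by rewrite fs //= negb_or ![_ == a]eq_sym ax.
Qed.

Lemma testP k st : ready st -> marked st 10 \subset marked st 11 ->
  let st' := den (test k) st in
  if bounded e k (marked st 11) && (marked st 10 != marked st 11)
  then st' 30 0 != 0 /\ marked st' 12 = marked st 11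
  else st' 30 0 = st 30 0 /\ marked st' 12 = marked st 12.
Proof.
move=> rst QR /=; rewrite /test den_seqs; set s1 := den (check k) st.
have s1f a i : a \in [:: 0; 10; 11; 12; 30] -> s1 a i = st a i.
  by rewrite !inE /s1 => /or4P[|||/orP[]] /eqP->; rewrite den_frame.
have s127 : (s1 27 0 != 0) = bounded e k (marked st 11) by apply: checkP.
rewrite den_seqs den_set den_seqs; set s2 := update s1 _ _ _.
set s3 := den _ s2.
have s3f a i : a \in [:: 0; 10; 11; 12; 30] -> s3 a i = st a i.
  move=> na; rewrite -s1f //; move: na.
  by rewrite !inE /s3 => /or4P[|||/orP[]] /eqP->; rewrite den_frame.
have s327 : s3 27 0 = s1 27 0 by rewrite /s3 den_frame.
have s329 : (s3 29 0 != 0) = (marked st 10 != marked st 11).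
  rewrite /s3 (@den_count 23 29 _ _ (fun j => (j \in marked st 11) &&
    (j \notin marked st 10))) //.
  - rewrite cards_eq0 [in RHS]eqEsubset QR /= -setD_eq0; congr (~~ (_ == _)).
    by apply/setP => j; rewrite !inE andbC.
  - by rewrite /s2 /update /= s1f //; case: rst.
  move=> j s s23 fs; rewrite !evalE s23 !fs // /s2 /update /= !s1f // !inE.
  by rewrite negbK eqb0 negbK.
rewrite den_seqs den_seqs0 den_if evalE !evalE s327 s127 s329 eqb0 negbK.
case: ifPn => [->|/negPf->]; last first.
  rewrite den_skip; split; first exact: s3f.
  by apply: marked_frame => i; rewrite s3f.
rewrite den_seq den_set; set s4 := update s3 _ _ _.
have s4f i : s4 11 i = st 11 i by rewrite /s4 /update /= s3f.
rewrite den_frame // den_copy //; last by rewrite /s4 /update /= s3f //; case: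
  rst.
by split=> //; apply: marked_frame.
Qed.

(** The level [m] of the recursion has its own counter [100 + m], so that nested loops do not
    disturb each other. *)
Lemma writes_search a k m : a \notin [:: 11; 12; 13; 22; 23; 24; 25; 26; 27; 28;
  29; 30] -> ~~ (100 < a <= 100 + m) -> ~~ writes a (search k m).
Proof.
elim: m => [|m IHm] na am.
  by move: na; rewrite /= !inE; lia.
have wm : ~~ writes a (search k m) by apply: IHm => //; lia.
rewrite /= (negPf wm) !orbF /=.
have -> : (100 + m.+1 == a) = false by lia.
by move: na; rewrite !inE eq_sym; case: (11 == a).
Qed.

Lemma ready_search k m st : ready st -> ready (den (search k m) st).
Proof. by apply: ready_den; rewrite !negb_or !writes_search. Qed.

Lemma searchP k m c (Q : {set T}) st : ready st -> marked st 10 = Q ->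
  let found (s : store) := s 30 0 != 0 -> [/\ bounded e k (marked s 12),
      Q \proper marked s 12 & #|marked s 12 :\: Q| <= c] in
  Q \subset marked st 11 -> #|marked st 11 :\: Q| + m <= c -> found st ->
  let st' := den (search k m) st in
  [/\ found st', marked st' 11 = marked st 11, st 30 0 != 0 -> st' 30 0 != 0
    & forall R, bounded e k R -> Q \proper R -> marked st 11 \subset R ->
        #|R :\: marked st 11| <= m -> st' 30 0 != 0].
Proof.
move=> rst st10 found; move: st rst st10; elim: m => [|m IHm] st rst st10.
  move=> QR Rc fst st'; have := testP k rst.
  rewrite st10 => /(_ QR); rewrite -/(search k 0) -/st' /=.
  have R' : marked st' 11 = marked st 11.
    by apply: marked_frame => i; rewrite /st' den_frame.
  have RE (R : {set T}) : marked st 11 \subset R ->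
      #|R :\: marked st 11| <= 0 -> R = marked st 11.
    move=> sR; rewrite leqn0 cards_eq0 setD_eq0 => Rs.
    by apply/eqP; rewrite eqEsubset Rs.
  case: ifPn => [/andP[bR nR] [-> E]|nb [E30 E12]]; split=> //.
  - by move=> _; rewrite E bR properEneq nR QR -(addn0 #|_|).
  - by rewrite /found E30 E12.
  - by rewrite E30.
  by move=> R bR QpR /RE H /H ER; case/negP: nb; rewrite -ER bR /= proper_neq.
move=> QR Rc fst /=; rewrite den_seq; set s1 := den (search k m) st.
have [|f1 e1 m1 c1] := IHm st rst st10 QR _ fst; first by lia.
rewrite -/s1 in f1 e1 m1 c1.
have rs1 : ready s1 by apply: ready_search.
have s110 : marked s1 10 = Q.
  by rewrite -st10; apply: marked_frame => i; rewrite /s1 den_frame //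
    writes_search.
set x := 100 + m.+1; set p := LIf _ _ _.
have wx : ~~ writes x (search k m) by apply: writes_search; rewrite ?inE; lia.
(* In the last clause, sets lacking at most [m] vertices were handled by the first recursive call;
   sets lacking [m.+1] are handled once the loop has passed a missing vertex. *)
pose I j (s : store) := [/\ found s, marked s 11 = marked st 11,
    st 30 0 != 0 -> s 30 0 != 0
  & forall R, bounded e k R -> Q \proper R -> marked st 11 \subset R ->
     #|R :\: marked st 11| <= m \/
       (exists2 i : T, i < j & i \in R :\: marked st 11) /\
          #|R :\: marked st 11| <= m.+1 -> s 30 0 != 0].
suff [If I11 I30 IR] : I n (den (LFor x p) s1).
  split=> // R bR QR' sR; rewrite leq_eqVlt => /orP[/eqP Rm|Rm]; last first.
    by apply: (IR R) => //; left.
  apply: (IR R) => //; right; rewrite Rm; split=> //.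
  have /card_gt0P[i iR] : 0 < #|R :\: marked st 11| by rewrite Rm.
  by exists i.
have wp a : a \notin [:: 11; 12; 13; 22; 23; 24; 25; 26; 27; 28; 29; 30] ->
    ~~ (100 < a <= 100 + m.+1) -> ~~ writes a (LFor x p).
  by move=> na am; have := writes_search k na am; rewrite /= => /norP[].
have p0 : ~~ writes 0 p by have /norP[] := wp 0 isT isT.
apply: den_for => //.
- by case: rs1.
- by rewrite /= !negb_or wx.
- split=> // R bR QpR sR [|[[] //]]; exact: c1.
move=> j s sx fs [If I11 I30 IR].
have rs : ready s.
  apply: ready_frame rs1 => a i aa; apply: fs.
  by move: aa; rewrite !inE => /or3P[]/eqP->; apply: wp.
have s10 : marked s 10 = Q.
  by rewrite -s110; apply: marked_frame => i; apply: fs; apply: wp.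
rewrite /p den_if evalE sx; have [sj|sj] := eqVneq (s 11 j) 0; last first.
  rewrite den_skip; split=> // R bR QpR sR [?|[[i ij iR] Rm]].
    by apply: (IR R) => //; left.
  apply: (IR R) => //; right; split=> //; exists i => //.
  move: ij; rewrite ltn_ordS => /orP[/eqP ij|//].
  by move: iR; rewrite ij -I11 !inE sj.
rewrite /= den_seq den_put !evalE sx; set s2 := update s _ _ _.
rewrite den_seq; set s3 := den (search k m) s2.
rewrite den_seq den_skip den_put; set s4 := update s3 _ _ _.
have s2R : marked s2 11 = j |: marked st 11.
  rewrite -I11; apply/setP => i; rewrite !inE /s2 /update /= (inj_eq val_inj).
  by case: (i == j).
have jR : j \notin marked st 11 by rewrite -I11 inE sj.
have rs2 : ready s2 by apply: ready_update.
have [||||f3 e3 m3 c3] := IHm s2 rs2.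
- by rewrite -s10; apply: marked_frame.
- by rewrite s2R (subset_trans QR) // subsetUr.
- rewrite s2R setDUl; apply: leq_trans Rc; rewrite addnS -addSn leq_add2r.
  apply: leq_trans (leq_card_setU _ _) _; rewrite -[leqRHS]add1n leq_add2r.
  by rewrite -(cards1 j) subset_leq_card // subsetDl.
- exact: If.
rewrite -/s3 in f3 e3 m3 c3.
have s3x : s3 x 0 = j by rewrite /s3 den_frame.
split.
- exact: f3.
- apply/setP => i; rewrite inE /s4 /update !evalE s3x /= (inj_eq val_inj).
  have := e3; rewrite s2R => /setP/(_ i); rewrite !inE; move: jR; rewrite inE.
  by have [->|//] := eqVneq i j; move/negPf->.
- by move/I30/m3.
move=> R bR QpR sR [Rm|[[i ij iR] Rm]].
  by apply/m3/(IR R) => //; left.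
move: ij; rewrite ltn_ordS => /orP[/eqP ij|ij]; last first.
  by apply/m3/(IR R) => //; right; split=> //; exists i.
apply: (c3 R) => //; rewrite s2R.
  by rewrite subUset sR sub1set andbT -ij; move: iR; rewrite inE => /andP[].
rewrite setUC -setDDl; have := cardsD1 j (R :\: marked st 11).
by rewrite -ij iR; lia.
Qed.

End Specs.

(** * Building the ordering from successive extensions *)

Definition insert :=
  LFor 23 (LIf (eAnd (cell 12 23) (eNot (cell 10 23)))
    (seqs [:: LPut 10 (V 23) (Cst 1);
              LPut 14 (V 31) (V 23);
              setv 31 (Add (V 31) (Cst 1))]) LSkip).

Definition grow k m :=
  LIf (Defs.Sub (V 0) (V 31))
    (seqs [:: setv 30 (Cst 0);
              LFor 23 (LPut 11 (V 23) (cell 10 23));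
              search k m;
              LIf (V 30) insert (setv 32 (Cst 1))])
    LSkip.

Definition ordering k m := LFor 33 (grow k m).

Section OrderSpecs.
Variable G : sgraph.
Notation n := (nvert G).
Notation T := 'I_(nvert G).
Notation e := (@adj G).

Record ordered (st : store) k (L : seq T) : Prop := Ordered {
  ordered_uniq : uniq L;
  ordered_set : marked G st 10 = [set x in L];
  ordered_val : [seq val x | x <- L] = mkseq (st 14) (st 31 0);
  ordered_bounded : forall j, bounded e k [set x in take j L]
}.

Lemma ordered_size st k L : ordered st k L -> size L = st 31 0.
Proof. by case=> _ _ /(congr1 size); rewrite size_map size_mkseq. Qed.

Lemma ordered_frame st st' k L :
  (forall a i, a \in [:: 10; 14; 31] -> st' a i = st a i) ->
  ordered st k L -> ordered st' k L.
Proof.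
move=> f [uL sL vL bL]; split=> //.
  by rewrite -sL; apply: marked_frame => i; rewrite f // ?inE ?eqxx ?orbT.
rewrite vL f; last by rewrite !inE eqxx !orbT.
by apply: eq_mkseq => i; rewrite f // !inE eqxx !orbT.
Qed.

Lemma ordered_rcons st k L (b : T) : ordered st k L -> b \notin L ->
  bounded e k [set x in rcons L b] ->
  ordered (update (update (update st 10 b 1) 14 (st 31 0) b) 31 0 (st 31 0 + 1))
    k (rcons L b).
Proof.
move=> oL bL bdL; case: (oL) => uL sL vL pL; split.
- by rewrite rcons_uniq bL.
- apply/setP => i; rewrite in_set [RHS]in_set mem_rcons inE /update /=.
  rewrite (inj_eq val_inj); move/setP/(_ i): sL; rewrite !in_set => <-.
  by case: (i == b).
- rewrite map_rcons vL -(ordered_size oL) /update /= addn1 mkseqS eqxx.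
  congr rcons; apply/eq_in_map => i; rewrite mem_iota /= add0n => iL.
  by rewrite (ltn_eqF iL).
move=> j; have [jL|jL] := leqP j (size L).
  by rewrite -cats1 takel_cat.
by rewrite take_oversize // size_rcons.
Qed.

(** The new vertices are appended one by one. Each intermediate prefix exceeds a set with boundaries
    of size at most [k] by at most [m] vertices, whence [k + m]. *)
Lemma insertP k m st L : ready G st -> ordered st (k + m) L ->
  bounded e k [set x in L] -> [set x in L] \subset marked G st 12 ->
  #|marked G st 12 :\: [set x in L]| <= m ->
  exists L', ordered (den insert st) (k + m) L' /\
    [set x in L'] = marked G st 12.
Proof.
move=> rst oL bQ sQB cB; set B := marked G st 12 in sQB cB *.
pose I j (s : store) := exists L', [/\ ordered s (k + m) L',
  [set x in L] \subset [set x in L'], [set x in L'] \subset B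
  & forall i : T, i \in B -> i < j -> i \in L'].
suff [L' [oL' _ LB BL]] : I n (den insert st).
  exists L'; split=> //; apply/eqP; rewrite eqEsubset LB.
  by apply/subsetP => i iB; rewrite inE BL.
apply: den_for => //; first by case: rst.
- move=> j s v [L' [oL' sL LB BL]]; exists L'; split=> //.
  by apply: ordered_frame oL' => a i; rewrite !inE => /or3P[] /eqP->.
- by exists L; split=> // i _; rewrite ltn0.
move=> j s s23 fs [L' [oL' sL LB BL]].
have jB : (s 12 j != 0) = (j \in B) by rewrite inE fs.
have jL : (s 10 j != 0) = (j \in L').
  by case: oL' => _ /setP/(_ j); rewrite !inE.
rewrite den_if !evalE s23 !eqb0 !negbK -[s 10 j == 0]negbK jB jL.
have [/andP[jB' jL']|nj] := boolP (_ && _); last first.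
  rewrite den_skip; exists L'; split=> // i iB; rewrite ltn_ordS.
  case/orP=> [/eqP ij|]; last exact: BL.
  by move: nj; rewrite -ij iB /= negbK.
have LB' : [set x in rcons L' j] \subset B.
  apply/subsetP => i; rewrite in_set mem_rcons inE => /orP[/eqP->//|iL'].
  by apply: (subsetP LB); rewrite inE.
have sL' : [set x in L] \subset [set x in rcons L' j].
  apply: (subset_trans sL); apply/subsetP => i.
  by rewrite !in_set mem_rcons inE => ->; rewrite orbT.
exists (rcons L' j); split=> //.
  rewrite -[den _ s]/(update (update (update s 10 (s 23 0) 1)
    14 (s 31 0) (s 23 0)) 31 0 (s 31 0 + 1)) s23.
  apply: ordered_rcons => //; apply: bounded_between bQ sL' _.
  by apply: leq_trans cB; rewrite subset_leq_card // setSD.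
move=> i iB; rewrite ltn_ordS mem_rcons inE => /orP[->//|ij].
by rewrite BL ?orbT.
Qed.

Definition stuck k m := exists Q : {set T}, [/\ bounded e k Q, Q != setT
  & forall R, bounded e k R -> Q \proper R -> m < #|R :\: Q|].

Lemma growP k m st L : ready G st -> ordered st (k + m) L ->
  bounded e k [set x in L] ->
  exists L', [/\ ordered (den (grow k m) st) (k + m) L',
    bounded e k [set x in L'], size L <= size L',
    st 32 0 != 0 -> den (grow k m) st 32 0 != 0
  & [\/ size L = n /\ den (grow k m) st 32 0 = st 32 0,
       size L < size L' /\ den (grow k m) st 32 0 = st 32 0
     | stuck k m /\ den (grow k m) st 32 0 != 0]].
Proof.
move=> rst oL bL; have st0 : st 0 0 = n by case: rst.
have sLn : size L <= n.
  by rewrite -[X in _ <= X]card_ord -(card_uniqP (ordered_uniq oL)) max_card.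
rewrite /grow den_if !evalE st0 -(ordered_size oL) -lt0n subn_gt0.
case: ltnP => [Ln|nL]; last first.
  by exists L; rewrite den_skip; split=> //; apply: Or31; split=> //; lia.
rewrite den_seqs den_set den_seqs; set s1 := update st _ _ _.
set s2 := den (LFor 23 _) s1.
rewrite den_seqs; set s3 := den (search k m) s2; rewrite den_seqs den_seqs0.
have s2f a i : a \in [:: 0; 1; 5; 10; 14; 31; 32] -> s2 a i = st a i.
  rewrite !inE /s2 => /or4P[|||/or4P[]] /eqP->; rewrite den_frame //.
have s3f a i : a \in [:: 0; 1; 5; 10; 14; 31; 32] -> s3 a i = st a i.
  move=> na; rewrite -s2f //; move: na.
  by rewrite !inE /s3 => /or4P[|||/or4P[]] /eqP->; rewrite den_frame //;
    apply: writes_search.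
have rs2 : ready G s2.
  by apply: ready_frame rst => a i; rewrite !inE => /or3P[]/eqP->; apply: s2f.
have Q10 : marked G s2 10 = [set x in L].
  by rewrite -(ordered_set oL); apply: marked_frame => i; rewrite s2f.
have Q11 : marked G s2 11 = [set x in L].
  rewrite /s2 den_copy // -(ordered_set oL).
  exact: marked_frame.
have s230 : s2 30 0 = 0 by rewrite /s2 den_frame.
have [|||] := @searchP G k m m [set x in L] s2 rs2 Q10.
- by rewrite Q11.
- by rewrite Q11 setDv cards0.
- by rewrite s230.
rewrite -/s3 Q11 => found3 _ _ all3.
have oL3 : ordered s3 (k + m) L.
  apply: ordered_frame oL => a i; rewrite !inE => na; apply: s3f.
  by case/or3P: na => /eqP->.
have rs3 : ready G s3 by apply: ready_search.
rewrite den_if evalE; have [f30|f30] := eqVneq (s3 30 0) 0; last first.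
  have [bB QB cB] := found3 f30.
  have [L' [oL' L'B]] := insertP rs3 oL3 bL (proper_sub QB) cB.
  have LL' : size L < size L'.
    rewrite -(card_uniqP (ordered_uniq oL)) -(card_uniqP (ordered_uniq oL')).
    apply: (@leq_trans #|[set x in L']|); last first.
      by rewrite cardsE.
    by rewrite L'B -(cardsE [in L]); apply: proper_card.
  have E32 : den insert s3 32 0 = st 32 0 by rewrite den_frame // s3f.
  exists L'; split=> //=.
  - by rewrite L'B.
  - exact: ltnW.
  - by rewrite E32.
  by apply: Or32.
exists L; split=> //.
- by apply: ordered_frame oL3 => a i; rewrite !inE => /or3P[] /eqP->.
apply: Or33; split=> //; exists [set x in L]; split=> //.
  apply: contraTneq Ln => LT; rewrite -leqNgt -[X in X <= _]card_ord.
  by rewrite -cardsT -LT cardsE (card_uniqP (ordered_uniq oL)).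
move=> R bR QR; rewrite ltnNge; apply/negP => Rm.
by have := all3 R bR QR (proper_sub QR) Rm; rewrite f30.
Qed.

(** Each round that is not stuck adds a vertex unless all are ordered, so [n] rounds suffice. *)
Lemma orderingP k m st : ready G st -> (forall i, st 10 i = 0) -> st 31 0 = 0 ->
  st 32 0 = 0 ->
  (den (ordering k m) st 32 0 != 0 /\ stuck k m) \/
  (den (ordering k m) st 32 0 = 0 /\
     exists2 L, ordered (den (ordering k m) st) (k + m) L & size L = n).
Proof.
move=> rst st10 st31 st32.
pose I j (s : store) := exists L,
  [/\ ordered s (k + m) L, bounded e k [set x in L], s 32 0 != 0 -> stuck k m
    & s 32 0 = 0 -> j <= size L \/ size L = n].
suff [L [oL _ fL cL]] : I n (den (ordering k m) st).
  have [s32|/[dup] s32 /fL] := eqVneq (den (ordering k m) st 32 0) 0; last by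
    left.
  right; split=> //; exists L => //; case: (cL s32) => // nL.
  apply/eqP; rewrite eqn_leq nL andbT -[X in _ <= X]card_ord.
  by rewrite -(card_uniqP (ordered_uniq oL)) max_card.
have wg a : a \notin [:: 10; 11; 12; 13; 14; 22; 23; 24; 25; 26; 27; 28; 29; 30;
    31; 32] -> ~~ (100 < a <= 100 + m) -> ~~ writes a (grow k m).
  move=> na am; have ws : ~~ writes a (search k m).
    by apply: writes_search => //; move: na; rewrite !inE; lia.
  by move: na; rewrite /= (negPf ws) !inE; lia.
have b0 k' : bounded e k' set0.
  apply/forall_inP => u _; rewrite (_ : boundary e set0 u = set0) ?cards0 //.
  by apply/setP => b; rewrite !inE.
have nil0 : [set x in [::] : seq T] = set0 by apply/setP => x; rewrite !inE.
apply: den_for => //; first by case: rst.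
- exact: wg.
- exact: wg.
- move=> j s v [L [oL bL fL cL]]; exists L; split=> //.
  by apply: ordered_frame oL => a i; rewrite !inE => /or3P[] /eqP->.
- exists [::]; split=> //; last by left.
  + split=> //.
    * by apply/setP => x; rewrite !inE st10.
    * by rewrite st31.
  by rewrite st32.
move=> j s s33 fs [L [oL bL fL cL]].
have rs : ready G s.
  apply: ready_frame rst => a i na; apply: fs => /=.
  have -> : (33 == a) = false by move: na; rewrite !inE; lia.
  by rewrite wg //; move: na; rewrite !inE; lia.
have [L' [oL' bL' sL' mono alt]] := growP rs oL bL.
exists L'; split=> //.
  by case: alt => [[_ ->]|[_ ->]|[]].
have L'n : size L' <= n.
  by rewrite -[X in _ <= X]card_ord -(card_uniqP (ordered_uniq oL')) max_card.
case: alt => [[nL _]|[LL' ->] /cL[jL|nL]|[_ /negPf s'32 /eqP]].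
- by right; lia.
- by left; apply: leq_ltn_trans jL LL'.
- by right; lia.
by rewrite s'32.
Qed.

End OrderSpecs.

(** * The contraction of the graph along the ordering *)

Definition relabeling :=
  LFor 46 (LIf (eEq (cell 15 46) (V 44)) (LPut 15 (V 46) (V 45)) LSkip).

(** The adjacency matrix of the input is consulted rather than a current trigraph: by tameness the
    two agree between different pieces. *)
Definition differ :=
  LSeq (setv 49 (Cst 0)) (LFor 46 (setv 49 (Add (V 49)
    (eAnd (eNot (eEq (cell 15 46) (V 45)))
          (eNot (eEq (eAdj 47 46) (eAdj 48 46))))))).

Definition emit :=
  seqs [:: LPut 16 (V 48) (Cst 1);
           LPut 3 (Get 2 (Cst 1)) (V 47);
           LPut 4 (Get 2 (Cst 1)) (V 48);
           LPut 2 (Cst 1) (Add (Get 2 (Cst 1)) (Cst 1))].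

Definition attempt :=
  LIf (eAnd (eAnd (eNot (eEq (V 47) (V 48)))
                  (eAnd (eNot (cell 16 47)) (eNot (cell 16 48))))
            (eAnd (eEq (cell 15 47) (V 45)) (eEq (cell 15 48) (V 45))))
    (LSeq differ (LIf (V 49) LSkip emit)) LSkip.

Definition reduction := LFor 47 (LFor 48 attempt).

(** The sum of the two tests is their disjunction; cell 41 is 0 exactly in the last stage, where
    everything gets merged. *)
Definition join :=
  LIf (Add (eAnd (cell 17 43) (eAdj 42 43)) (eNot (V 41)))
    (seqs [:: setv 44 (cell 15 43); setv 45 (cell 15 42); relabeling;
      reduction])
    LSkip.

Definition stage :=
  seqs [:: setv 41 (Defs.Sub (Defs.Sub (V 0) (V 40)) (Cst 1));
           setv 42 (cell 14 41);
           LFor 43 join;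
           LPut 17 (V 42) (Cst 1)].

Definition contraction :=
  seqs [:: LFor 23 (LPut 15 (V 23) (V 23));
           LFor 40 stage;
           LPut 2 (Cst 0) (Cst 1)].

Section ContractionSpecs.
Variable G : sgraph.
Notation n := (nvert G).
Notation T := 'I_(nvert G).
Notation e := (@adj G).
Variable c : nat.

Record traced (st : store) (cmp : T -> nat) (s : seq (T * T)) H : Prop := Traced
  {
  traced_reached : reached c (tri G) s H;
  traced_out : [seq (val p.1, val p.2) | p <- s]
    = mkseq (fun k => (st 3 k, st 4 k)) (st 2 1);
  traced_alive : forall i : T, (i \in tvert H) = (st 16 i == 0);
  traced_label : forall i : T, st 15 i = cmp i;
  traced_tame : tame e cmp H
}.

Lemma traced_frame st st' cmp s H :
  (forall a i, a \in [:: 2; 3; 4; 15; 16] -> st' a i = st a i) ->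
  traced st cmp s H -> traced st' cmp s H.
Proof.
move=> f [rH oH aH lH tH]; split=> //.
- by rewrite oH (f 2) //; apply: eq_mkseq => k /=; rewrite (f 3) // (f 4).
- by move=> i; rewrite f.
by move=> i; rewrite f.
Qed.

Lemma relabelingP st cmp u v : st 0 0 = n -> (forall i : T, st 15 i = cmp i) ->
  st 44 0 = cmp u -> st 45 0 = cmp v ->
  forall i : T, den relabeling st 15 i = relabel cmp (cmp u) (cmp v) i.
Proof.
move=> st0 lab s44 s45.
pose I j (s : store) := forall i : T,
  s 15 i = if i < j then relabel cmp (cmp u) (cmp v) i else cmp i.
suff Is : I n (den relabeling st) by move=> i; rewrite Is ltn_ord.
apply: den_for => // j s s46 fs Is i.
have sj : s 15 j = cmp j by rewrite Is ltnn.
rewrite den_if !evalE s46 sj fs // s44 eqb0 negbK ltn_ordS /relabel.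
have [->|ij] := eqVneq i j.
  case: (cmp j == cmp u); last by rewrite den_skip.
  by rewrite denE !evalE s46 /update !eqxx /= fs // s45.
case: (cmp j == cmp u); last by rewrite den_skip Is.
by rewrite denE !evalE s46 /update (inj_eq val_inj) (negPf ij) Is.
Qed.

(** The property holds vacuously when one of the vertices has vanished, hence survives every later
    contraction. *)
Definition distinct (cmp : T -> nat) H (v x y : T) := x \in tvert H -> y \in
  tvert H -> x != y ->
  cmp x = cmp v -> cmp y = cmp v -> exists2 w : T, cmp w != cmp v & e x w != e y
    w.

Lemma attemptP st cmp s H (v x y : T) : ready G st -> traced st cmp s H ->
  (forall z, #|block cmp H z| <= c.+1) ->
  st 45 0 = cmp v -> st 47 0 = x -> st 48 0 = y ->
  exists s' H', [/\ traced (den attempt st) cmp s' H', tvert H' \subset tvert H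
    & distinct cmp H' v x y].
Proof.
move=> rst tr bH s45 s47 s48; case: (tr) => rH oH aH lH tH.
rewrite /attempt den_if !evalE s47 s48 !lH s45 !eqb0 !negbK (inj_eq val_inj).
rewrite -!aH; have [|no] := boolP (_ && _); last first.
  exists s, H; rewrite den_skip; split=> // xH yH nxy cx cy.
  by move: no; rewrite nxy xH yH cx cy eqxx.
case/andP=> /andP[nxy /andP[xH yH]] /andP[/eqP cx /eqP cy].
rewrite den_seq; set st1 := den differ st.
have s1f a i : a != 49 -> a != 46 -> st1 a i = st a i.
  by move=> a9 a6; rewrite /st1 den_frame //= !negb_or ![_ == a]eq_sym a9 a6.
have s149 : st1 49 0 = #|[set w | (cmp w != cmp v) && (e x w != e y w)]|.
  rewrite /st1 den_seq den_set.
  apply: (@den_count G 46 49 _ _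
    (fun w => (cmp w != cmp v) && (e x w != e y w))) => //.
    by case: rst.
  move=> w st2 s246 fs2; have rs2 : ready G st2.
    by apply: ready_frame rst => a i; rewrite !inE => /or3P[]/eqP->; rewrite
      fs2.
  have s247 : st2 47 0 = x by rewrite fs2.
  have s248 : st2 48 0 = y by rewrite fs2.
  rewrite !evalE (eval_adj rs2 s247 s246) (eval_adj rs2 s248 s246).
  have s245 : st2 45 0 = cmp v by rewrite fs2.
  have l2 : st2 15 w = cmp w by rewrite fs2 // -lH.
  rewrite s246 l2 s245 !eqb0 !negbK.
  by case: (e x w); case: (e y w).
have tr1 : traced st1 cmp s H.
  by apply: traced_frame tr => a i na; apply: s1f; apply: contraTneq na => ->.
rewrite den_if evalE s149 cards_eq0.
have [/eqP E|/set0Pn[w]] := boolP (_ == set0); last first.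
  rewrite inE => /andP[wv exy]; exists s, H; rewrite den_skip; split=> //.
  by move=> _ _ _ _ _; exists w.
rewrite -[den emit st1]/(update (update (update (update st1 16 (st1 48 0) 1)
  3 (st1 2 1) (st1 47 0)) 4 (st1 2 1) (st1 48 0)) 2 1 (st1 2 1 + 1)).
rewrite !(s1f 47) // !(s1f 48) // s47 s48.
exists (rcons s (x, y)), (contract H x y); split.
- case: tr1 => _ oH1 aH1 lH1 _; split=> //.
  + apply: ReachedRcons => //; exact: tame_red_deg tH bH.
  + rewrite map_rcons oH1 /update /= addn1 mkseqS !eqxx.
    congr rcons; apply/eq_in_map => k; rewrite mem_iota add0n => /andP[_ kl].
    by rewrite (ltn_eqF kl).
  + move=> i; rewrite in_contract_vert // aH1 /update /= (inj_eq val_inj).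
    by case: (i == y).
  apply: (tame_contract (@adj_sym G)) => //; first by rewrite cx cy.
  move=> w cw; apply/eqP/negPn/negP => exy.
  have : w \in (set0 : {set T}) by rewrite -E inE -cx cw.
  by rewrite inE.
- by apply/subsetP => z; rewrite in_contract_vert // => /andP[].
by move=> _; rewrite in_contract_vert // eqxx.
Qed.

Lemma block_sub cmp H H' (z : T) : tvert H' \subset tvert H ->
  #|block cmp H' z| <= #|block cmp H z|.
Proof.
move=> /subsetP sH; apply/subset_leq_card/subsetP => w.
by rewrite !inE => /andP[/sH-> ->].
Qed.

(** One pass over the pairs is enough: whether two vertices are told apart depends on [e] and [cmp]
    only, so a pair that is settled remains so. *)
Lemma reductionP st cmp s H (v : T) : ready G st -> traced st cmp s H ->
  (forall z, #|block cmp H z| <= c.+1) -> st 45 0 = cmp v ->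
  exists s' H', [/\ traced (den reduction st) cmp s' H',
    tvert H' \subset tvert H & forall x y, distinct cmp H' v x y].
Proof.
move=> rst tr bH s45.
have dsub H1 H2 x y : tvert H2 \subset tvert H1 ->
    distinct cmp H1 v x y -> distinct cmp H2 v x y.
  by move=> /subsetP sH d xH yH; apply: d; apply: sH.
pose I j (s2 : store) := exists s' H', [/\ traced s2 cmp s' H',
    tvert H' \subset tvert H & forall x y : T, x < j -> distinct cmp H' v x y].
suff [s' [H' [tr' sH' d]]] : I n (den reduction st).
  by exists s', H'; split=> // x y; apply: d.
apply: den_for => //; first by case: rst.
- move=> j s2 w [s' [H' [tr' sH' d]]]; exists s', H'; split=> //.
  by apply: traced_frame tr' => a i; rewrite !inE => /or4P[|||/orP[]] /eqP->.
- by exists s, H; split=> // x y; rewrite ltn0.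
move=> x s2 s247 fs [s' [H' [tr' sH' d]]].
have rs2 : ready G s2.
  by apply: ready_frame rst => a i; rewrite !inE => /or3P[]/eqP->; apply: fs.
pose J j (s3 : store) := exists s'' H'', [/\ traced s3 cmp s'' H'',
    tvert H'' \subset tvert H' & forall y : T, y < j -> distinct cmp H'' v x y].
suff [s'' [H'' [tr'' sH'' d']]] : J n (den (LFor 48 attempt) s2).
  exists s'', H''; split=> //; first exact: subset_trans sH'' sH'.
  move=> x' y; rewrite ltn_ordS => /orP[/eqP->|x'x]; first exact: d'.
  by apply: dsub sH'' _; apply: d.
apply: den_for => //; first by case: rs2.
- move=> j s3 w [s'' [H'' [tr'' sH'' d']]]; exists s'', H''; split=> //.
  by apply: traced_frame tr'' => a i; rewrite !inE => /or4P[|||/orP[]] /eqP->.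
- by exists s', H'; split=> // y; rewrite ltn0.
move=> y s3 s348 fs3 [s'' [H'' [tr'' sH'' d']]].
have rs3 : ready G s3.
  by apply: ready_frame rs2 => a i; rewrite !inE => /or3P[]/eqP->; apply: fs3.
have bH'' z : #|block cmp H'' z| <= c.+1.
  by apply: leq_trans (block_sub _ _ (subset_trans sH'' sH')) (bH z).
have [||//|s4 [H4 [tr4 sH4 d4]]] := attemptP (v := v) (x := x) (y := y) rs3 tr''
  bH''.
- by rewrite fs3 // fs.
- by rewrite fs3.
exists s4, H4; split=> //; first exact: subset_trans sH4 sH''.
move=> y'; rewrite ltn_ordS => /orP[/eqP->//|y'y].
by apply: dsub sH4 _; apply: d'.
Qed.

Variable K : nat.
(** At worst, two reduced pieces have just been joined and not yet been reduced; the red degree is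
    one less than their total size. *)
Hypothesis cK : c.+1 = (2 ^ K).+1 + (2 ^ K).+1.

(** Reducing after each single join ensures that only one block is ever doubled. As labels only get
    coarser, the joins made earlier in the stage are kept. *)
Lemma joinP st cmp s H (Q : {set T}) (v u : T) :
  ready G st -> traced st cmp s H -> partial_merge e Q (Q :\ v) cmp ->
  v \in Q -> bounded e K (Q :\ v) ->
  (forall x, #|block cmp H x| <= (2 ^ K).+1) ->
  marked G st 17 = ~: Q -> st 42 0 = v -> st 43 0 = u ->
  (st 41 0 = 0 -> Q :\ v = set0) ->
  exists cmp' s' H', [/\ traced (den join st) cmp' s' H',
    partial_merge e Q (Q :\ v) cmp',
    forall x, #|block cmp' H' x| <= (2 ^ K).+1,
    forall x y, cmp x = cmp y -> cmp' x = cmp' y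
  & ((u \notin Q) && e v u -> cmp' u = cmp' v) /\
    (st 41 0 = 0 -> cmp' u = cmp' v /\ forall x y, distinct cmp' H' v x y)].
Proof.
move=> rst tr pm vQ bQ bH m17 s42 s43 s41.
have uQ : (st 17 u != 0) = (u \notin Q).
  by move/setP/(_ u): m17; rewrite !inE.
rewrite /join den_if !evalE (eval_adj rst s42 s43) s43 uQ !eqb0 !negbK.
rewrite addn_eq0 !eqb0 negb_and !negbK.
have [cond|/norP[nuv /eqP i0]] := boolP (_ || _); last first.
  exists cmp, s, H; rewrite den_skip; split=> //; split=> //.
  by rewrite (negPf nuv).
rewrite den_seqs den_set den_seqs den_set; set s2 := update _ 45 _ _.
rewrite den_seqs; set s3 := den relabeling s2; rewrite den_seqs den_seqs0.
have lab := traced_label tr.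
have s244 : s2 44 0 = cmp u by rewrite /s2 /update /= s43 lab.
have s245 : s2 45 0 = cmp v.
  by rewrite /s2 -[update _ 45 _ _ 45 0]/(st 15 (st 42 0)) s42 lab.
have s20 : s2 0 0 = n by case: rst.
set cmp1 := relabel cmp (cmp u) (cmp v).
have s3l : forall i : T, s3 15 i = cmp1 i by apply: relabelingP.
have s3f a i : a \notin [:: 15; 44; 45; 46] -> s3 a i = st a i.
  rewrite !inE !negb_or => /and4P[a15 a44 a45 a46].
  rewrite /s3 den_frame /=; last by rewrite !orbF ![_ == a]eq_sym negb_or a46.
  by rewrite /s2 /update (negPf a44) (negPf a45).
have tr3 : traced s3 cmp1 s H.
  case: tr => rH oH aH lH tH; split=> //; last exact: tame_relabel.
  - by rewrite oH (s3f 2) //; apply: eq_mkseq => j /=; rewrite (s3f 3) // (s3f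
      4).
  by move=> i; rewrite s3f.
have rs3 : ready G s3.
  by apply: ready_frame rst => a i; rewrite !inE => /or3P[]/eqP->; apply: s3f.
have pm1 : partial_merge e Q (Q :\ v) cmp1.
  apply: (partial_merge_relabel (@adj_sym G)) => //.
  case/orP: cond => [/andP[]|/eqP/s41]; [by right|by left].
have c1v : cmp1 v = cmp v by rewrite /cmp1 /relabel; case: eqP.
have c1u : cmp1 u = cmp v by rewrite /cmp1 /relabel eqxx.
have b1 x : #|block cmp1 H x| <=
    if cmp1 x == cmp v then (2 ^ K).+1 + (2 ^ K).+1 else (2 ^ K).+1.
  have [Euv|] := eqVneq (cmp u) (cmp v); last by move/block_relabel; apply.
  have cmpE z : cmp1 z = cmp z.
    by rewrite /cmp1 /relabel Euv; case: eqP.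
  apply: leq_trans (_ : (2 ^ K).+1 <= _); last by case: ifP => // _; rewrite
    leq_addr.
  apply: leq_trans (bH x); apply: eq_leq; apply: eq_card => z.
  by rewrite !inE !cmpE.
have [||s' [H' [tr' sH' d']]] := reductionP (v := v) rs3 tr3.
- by move=> z; apply: leq_trans (b1 z) _; rewrite cK; case: ifP => // _;
    rewrite leq_addr.
- by rewrite /s3 den_frame // c1v.
exists cmp1, s', H'; split=> //.
- move=> x; have [xv|xv] := eqVneq (cmp1 x) (cmp1 v).
    have -> : block cmp1 H' x = block cmp1 H' v.
      by apply/setP => z; rewrite !inE xv.
    apply: (card_reduced bQ vQ pm1) => x' y' x'H y'H nxy cx cy.
    exact: d'.
  apply: leq_trans (block_sub _ _ sH') _; apply: leq_trans (b1 x) _.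
  by rewrite -c1v (negPf xv).
- by move=> x y cxy; rewrite /cmp1 /relabel cxy.
by split=> _; rewrite c1u c1v.
Qed.

Lemma stageP st cmp s H (Q : {set T}) (v : T) :
  ready G st -> traced st cmp s H -> partial_merge e Q Q cmp ->
  v \in Q -> bounded e K (Q :\ v) ->
  (forall x, #|block cmp H x| <= (2 ^ K).+1) ->
  marked G st 17 = ~: Q -> st 14 (n - st 40 0 - 1) = v ->
  (n - st 40 0 - 1 = 0 -> Q :\ v = set0) ->
  exists cmp' s' H', [/\ traced (den stage st) cmp' s' H',
    partial_merge e (Q :\ v) (Q :\ v) cmp',
    forall x, #|block cmp' H' x| <= (2 ^ K).+1,
    marked G (den stage st) 17 = ~: (Q :\ v)
  & n - st 40 0 - 1 = 0 -> #|tvert H'| = 1].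
Proof.
move=> rst tr pm vQ bQ bH m17 s14 i0; have st0 : st 0 0 = n by case: rst.
rewrite /stage den_seqs den_set den_seqs den_set.
set s2 := update _ 42 _ _.
have s241 : s2 41 0 = n - st 40 0 - 1 by rewrite -st0.
have s242 : s2 42 0 = v.
  by rewrite -s14 -st0.
rewrite den_seqs; set s3 := den (LFor 43 join) s2.
have s3f a i : a \in [:: 0; 1; 5; 14; 17; 41; 42] -> s3 a i = s2 a i.
  by move=> na; rewrite /s3 den_frame //; move: na;
    rewrite !inE => /or4P[|||/or4P[]] /eqP->.
rewrite den_seqs den_seqs0 den_put !evalE s3f // s242.
have pmv := partial_merge_start pm vQ.
pose I j (s4 : store) := exists cmp' s' H', [/\ traced s4 cmp' s' H',
    partial_merge e Q (Q :\ v) cmp',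
    forall x, #|block cmp' H' x| <= (2 ^ K).+1,
    forall u : T, u < j -> (u \notin Q) && e v u -> cmp' u = cmp' v
  & n - st 40 0 - 1 = 0 -> (forall u : T, u < j -> cmp' u = cmp' v) /\
      (0 < j -> forall x y, distinct cmp' H' v x y)].
have [cmp' [s' [H' [tr' pm' b' m' d']]]] : I n s3.
  apply: den_for => //.
  - move=> j s4 w [cmp' [s' [H' [tr' pm' b' m' d']]]]; exists cmp', s', H'.
    split=> //; apply: traced_frame tr' => a i.
    by rewrite !inE => /or4P[|||/orP[]] /eqP->.
  - exists cmp, s, H; split=> //.
    by apply: traced_frame tr => a i; rewrite !inE => /or4P[|||/orP[]] /eqP->.
  move=> u s4 s443 fs [cmp' [s' [H' [tr' pm' b' m' d']]]].
  have rs4 : ready G s4.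
    apply: ready_frame rst => a i; rewrite !inE => /or3P[]/eqP->;
      exact: fs.
  have [|||cmp2 [sq2 [H2 [tr2 pm2 b2 coarse [m2 d2]]]]] :=
      joinP rs4 tr' pm' vQ bQ b' _ _ s443.
  - by rewrite -m17; apply: marked_frame => i; rewrite fs.
  - by rewrite fs.
  - by rewrite fs // s241.
  exists cmp2, sq2, H2; split=> //.
    move=> u'; rewrite ltn_ordS => /orP[/eqP->//|u'u] cond.
    by apply: coarse; apply: m'.
  rewrite -s241 -(fs 41) // => /[dup] z /d2[cuv dis]; split=> // u'.
  rewrite ltn_ordS => /orP[/eqP->//|u'u]; apply: coarse.
  by move: z; rewrite fs // s241 => /d'[->].
exists cmp', s', H'; split=> //.
- by apply: traced_frame tr' => a i; rewrite !inE => /or4P[|||/orP[]] /eqP->.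
- apply: (partial_merge_end (@adj_sym G)) pm' _ => u uQ evu.
  by apply: m'; rewrite ?uQ.
- apply/setP => i; rewrite !inE /update /= (inj_eq val_inj) s3f //.
  have [->|_] := eqVneq i v; first by [].
  by move/setP/(_ i): m17; rewrite !inE => <-.
(* In the last stage all labels agree, so no vertex can tell two others apart and a single one is
   left. *)
move=> z; have [cv dis] := d' z.
have {}dis := dis (nvert_gt0 G).
have [x xH] := set0Pn _ (tvert_neq0 H').
apply/eqP/cards1P; exists x; apply/setP => y; rewrite in_set1.
apply/idP/eqP => [yH|->//]; apply/eqP/negPn/negP => nyx.
have [||w] := dis y x yH xH nyx; rewrite ?cv //.
by rewrite eqxx.
Qed.

Lemma contractionP st (L : seq T) : ready G st -> ordered st K L -> size L = n
  ->
  (forall i, st 16 i = 0) -> (forall i, st 17 i = 0) -> st 2 1 = 0 ->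
  exists s, [/\ outputs_seq (den contraction st) s, contraction_seq (tri G) s
    & width (tri G) s <= c].
Proof.
move=> rst oL sL s16 s17 s21; have st0 : st 0 0 = n by case: rst.
have [uL mL vL bL] := oL.
have LT : [set x in L] = setT.
  apply/eqP; rewrite eqEcard subsetT cardsT card_ord cardsE.
  by rewrite (card_uniqP uL) sL leqnn.
rewrite /contraction den_seqs; set s1 := den (LFor 23 _) st.
rewrite den_seqs; set s2 := den (LFor 40 stage) s1.
rewrite den_seqs den_seqs0 den_put.
have s115 (i : T) : s1 15 i = i.
  pose I j (s : store) := forall i : T, i < j -> s 15 i = i.
  apply: (_ : I n s1) (ltn_ord i).
  apply: den_for => // j s s23 _ Is {}i.
  rewrite ltn_ordS denE !evalE s23 /update eqxx /= (inj_eq val_inj).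
  by have [->|_ /Is] := eqVneq i j.
have rs1 : ready G s1 by apply: ready_den.
pose Q j : {set T} := [set x in take (n - j) L].
pose I j (s3 : store) := exists cmp s H, [/\ traced s3 cmp s H,
    partial_merge e (Q j) (Q j) cmp,
    forall x, #|block cmp H x| <= (2 ^ K).+1,
    marked G s3 17 = ~: Q j & j = n -> #|tvert H| = 1].
suff [cmp [s [H [tr _ bH _ H1]]]] : I n s2.
  have mH : max_red_deg H <= c.
    apply: (tame_red_deg (traced_tame tr)) => x.
    by apply: leq_trans (bH x) _; rewrite cK leq_addr.
  have [sc sw] := reached_contraction_seq (traced_reached tr) (H1 erefl) mH.
  by exists s; split=> //; split=> //; apply: (traced_out tr).
apply: den_for => //.
- by rewrite /s1 den_frame.
- move=> j s3 w [cmp [s [H [tr pm bH m17 H1]]]]; exists cmp, s, H; split=> //.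
  by apply: traced_frame tr => a i; rewrite !inE => /or4P[|||/orP[]] /eqP->.
- exists (fun i : T => val i), [::], (tri G).
  have Q0 : Q 0 = setT by rewrite /Q subn0 take_oversize ?sL ?LT.
  rewrite Q0; split.
  + split=> //.
    * exact: ReachedNil.
    * by rewrite /s1 den_frame // s21.
    * by move=> i; rewrite /s1 den_frame // s16 inE.
  + split=> [u w|u w /val_inj->]; first by rewrite inE.
    by rewrite eqxx.
  + move=> x; rewrite (_ : block _ _ x = [set x]) ?cards1 //.
    by apply/setP => y; rewrite !inE /= (inj_eq val_inj).
  + by apply/setP => i; rewrite !inE /s1 den_frame // s17.
  by move=> n0; have := nvert_gt0 G; lia.
move=> j s3 s340 fs [cmp [s [H [tr pm bH m17 _]]]].
have rs3 : ready G s3.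
  by apply: ready_frame rs1 => a i; rewrite !inE => /or3P[]/eqP->; apply: fs.
have jn := ltn_ord j.
have nL : n - j.+1 < size L by rewrite sL; lia.
pose v := tnth (in_tuple L) (Ordinal nL).
have vE : v = nth v L (n - j.+1) by rewrite {1}/v (tnth_nth v).
have takeS : take (n - j) L = rcons (take (n - j.+1) L) v.
  by rewrite vE -take_nth // subnSK.
have vt : v \notin take (n - j.+1) L.
  have := take_uniq (n - j) uL; rewrite takeS rcons_uniq.
  by case/andP.
have QE : Q j :\ v = Q j.+1.
  apply/setP => x; rewrite in_setD1 !in_set takeS mem_rcons inE.
  by have [->|] := eqVneq x v; rewrite ?(negPf vt).
have vQ : v \in Q j by rewrite inE takeS mem_rcons inE eqxx.
have [|||cmp' [s' [H' [tr' pm' b' m' c']]]] := stageP (v := v) rs3 tr pm vQ _ bH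
  m17.
- by rewrite QE; apply: bL.
- rewrite s340 -subnDA addn1 fs // /s1 den_frame //.
  have := congr1 (fun l => nth 0 l (n - j.+1)) vL.
  rewrite (nth_map v) // -vE nth_mkseq //.
  by rewrite -(ordered_size oL).
- rewrite s340 -subnDA addn1 QE => z; apply/setP => x.
  by rewrite /Q z take0 !inE.
exists cmp', s', H'; rewrite -QE; split=> // jn'.
by apply: c'; rewrite s340; lia.
Qed.

End ContractionSpecs.

(** * The complete program and its correctness *)

Definition approximate k m :=
  seqs [:: rows; ordering k m; LIf (V 32) LSkip contraction].

Lemma well_formed_search k m : well_formed (search k m).
Proof.
elim: m => // m IHm.
have ws : ~~ writes (100 + m.+1) (search k m).
  by apply: writes_search; rewrite ?inE; lia.
by rewrite /= IHm (negPf ws).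
Qed.

Lemma well_formed_approximate k m :
  well_formed (approximate k m) && ~~ writes 0 (approximate k m).
Proof.
have wf := well_formed_search k m.
have w0 : ~~ writes 0 (search k m) by apply: writes_search.
have w33 : ~~ writes 33 (search k m) by apply: writes_search => //; lia.
by rewrite /= wf (negPf w0) (negPf w33).
Qed.

Theorem corollary1p3 (C : sgraph -> Prop)
    (hC : exists2 t : nat, 1 <= t &
       forall G : sgraph, C G -> ~ contains_subgraph (Kbip t) (@adj G)) :
  exists (c : nat) (A : prog) (p : {poly nat}),
    forall G : sgraph, C G ->
      exists (k : nat) (st : store),
        [/\ exec A (input G) k st,
            k <= p.[nvert G]%R
          & (exists s : seq ('I_(nvert G) * 'I_(nvert G)),
               [/\ outputs_seq st s,
                   contraction_seq (tri G) s
                 & width (tri G) s <= c])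
            \/ (outputs_large st /\ 2 < twin_width (tri G))].
Proof.
(* [k] and [m] come from [bounded_extend], and [K] bounds the boundaries of all the prefixes of the
   ordering. *)
case: hC => t t0 Kfree; pose k := 154 * t; pose m := 7 * t; pose K := k + m.
pose A := approximate k m; have /andP[wA A0] := well_formed_approximate k m.
exists ((2 ^ K).+1 + 2 ^ K), (compile A), (cost A) => G CG.
have [l exA lc] := exec_compile (input G) wA A0.
exists l, (den A (input G)); split=> //.
rewrite /A /approximate den_seqs; set s1 := den rows _.
have rs1 : ready G s1 by apply: rowsP.
rewrite den_seqs; set s2 := den (ordering k m) s1.
rewrite den_seqs den_seqs0 den_if evalE.
have s1f a i : a \notin [:: 5; 20; 21] -> s1 a i = input G a i.
  move=> na; rewrite /s1 den_frame //; move: na.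
  by rewrite !inE /=; lia.
have s2f a i : a \in [:: 0; 1; 2; 5; 16; 17] -> s2 a i = s1 a i.
  move=> na; have ws : ~~ writes a (search k m).
    by apply: writes_search; move: na; rewrite !inE; lia.
  by rewrite /s2 den_frame //= (negPf ws); move: na; rewrite !inE; lia.
have [|||[s232 [Q [bQ QT stuck]]]|[s232 [L oL sL]]] := @orderingP G k m s1 rs1.
- by move=> i; rewrite s1f.
- by rewrite s1f.
- by rewrite s1f.
- right; rewrite s232 den_skip; split; first by rewrite /outputs_large s2f //
    s1f.
  rewrite ltnNge; apply/negP => tw2.
  have /has_widthP[s sG sw] : has_width (tri G) (twin_width (tri G)).
    by rewrite /twin_width; case: ex_minnP.
  (* A set and its common neighbours are disjoint, as there are no loops, so [t] vertices from each
     span a [K_{t,t}]. *)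
  have small (B : {set 'I_(nvert G)}) : t <= #|B| -> #|common_nbr (@adj G) B| <=
    t.
    move=> tB; rewrite leqNgt; apply/negP => /ltnW tN.
    apply: (Kfree G CG).
    pose h (x : 'I_t + 'I_t) := match x with
      | inl i => enum_val (widen_ord tB i)
      | inr i => enum_val (widen_ord tN i) end.
    have hadj i j : adj (h (inr j)) (h (inl i)).
      have := enum_valP (widen_ord tN j); rewrite inE => /forall_inP; apply.
      exact: enum_valP.
    exists h.
      move=> [i|i] [j|j] E.
      - by congr inl; apply/val_inj/(congr1 val (enum_val_inj E)).
      - by have := hadj i j; rewrite E adj_irr.
      - by have := hadj j i; rewrite E adj_irr.
      by congr inr; apply/val_inj/(congr1 val (enum_val_inj E)).
    by move=> [i|i] [j|j] // _; rewrite adj_sym; apply: hadj.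
  have [|R [bR QR R7]] := bounded_extend (@adj_sym G) t0 _ bQ QT.
    (* At the start the parts are single vertices and nothing is red, so the invariant [chains]
       holds vacuously. *)
    move=> W; have q : quotient (@adj G) id (tri G).
      by split=> // u; rewrite inE.
    have sw2 : width (tri G) s <= 2 by rewrite sw.
    have ch : chains (@adj G) t id (tri G) by [].
    apply: (balanced_separation (@adj_sym G) small t0 q ch sG sw2) => a.
    apply: (@leq_trans 1); last by lia.
    rewrite -(cards1 a); apply/subset_leq_card/subsetP => u.
    by rewrite !inE => /andP[_].
  by have := stuck R bR QR; rewrite ltnNge R7.
left; rewrite [s2 32 0]s232 eqxx /=.
have rs2 : ready G s2.
  by apply: ready_frame rs1 => a i; rewrite !inE => /or3P[]/eqP->; apply: s2f.
apply: (contractionP (K := K)) oL sL _ _ _ => //.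
- by rewrite addnS.
- by move=> i; rewrite -/s2 s2f // s1f.
- by move=> i; rewrite -/s2 s2f // s1f.
by rewrite -/s2 s2f // s1f.
Qed.
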